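(* Apart from $K_6$, the ASP graphs are $5$-vertex-colorable in polynomial time.
   Context: Graphs are finite, simple and undirected. $P_k$ is the path on $k$ vertices. For a graph $H$, the skeleton of $H$ is its subgraph induced by the edges of $H$ both of whose ends have degree at least $3$ in $H$. $K_4\langle S\rangle$ denotes a subdivision of $K_4$ whose skeleton is isomorphic to $S$. A graph is ASP (almost series-parallel) if it contains no $K_4\langle P_3\rangle$ and no $K_4\langle P_4\rangle$ as a subgraph. $5$-vertex-colorable means having a proper vertex coloring with at most $5$ colors.
   Formalization: ''Apart from K_6'' is taken as ''ASP graphs with no K_6 subgraph'': the literal reading fails for K_6 plus an isolated vertex, which is ASP and not K_6 but is not 5-colorable; only graphs containing K_6, never 5-colorable, are excluded. *)

(* Defs.v *)
From mathcomp Require Import all_boot.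

Set Implicit Arguments.
Unset Strict Implicit.
Unset Printing Implicit Defensive.

(** * Graphs *)

Record sgraph := SGraph {
  vertex :> finType;
  edge : rel vertex;
  edge_sym : symmetric edge;
  edge_irrefl : irreflexive edge }.

Notation "x -- y" := (edge x y) (at level 30, no associativity).

Definition isomorphic (G H : sgraph) : Prop :=
  exists2 f : G -> H, bijective f & {mono f : x y / x -- y}.

(* Up to isomorphism, H is a (not necessarily induced) subgraph of G. *)
Definition subgraph (H G : sgraph) : Prop :=
  exists2 f : H -> G, injective f & {homo f : x y / x -- y}.

Definition degree (G : sgraph) (x : G) : nat := #|[set y | x -- y]|.

Section Complete.
Variable n : nat.
Definition complete_rel : rel 'I_n := fun x y => x != y.
Lemma complete_sym : symmetric complete_rel.
Proof. by move=> x y; rewrite /complete_rel eq_sym. Qed.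
Lemma complete_irrefl : irreflexive complete_rel.
Proof. by move=> x; rewrite /complete_rel eqxx. Qed.
Definition complete : sgraph := SGraph complete_sym complete_irrefl.
End Complete.

(* [path_graph k] has k vertices, hence k - 1 edges. *)
Section PathGraph.
Variable k : nat.
Definition path_rel : rel 'I_k :=
  fun x y => (x.+1 == y :> nat) || (y.+1 == x :> nat).
Lemma path_rel_sym : symmetric path_rel.
Proof. by move=> x y; rewrite /path_rel orbC. Qed.
Lemma path_rel_irrefl : irreflexive path_rel.
Proof. by move=> x; rewrite /path_rel orbb gtn_eqF. Qed.
Definition path_graph : sgraph := SGraph path_rel_sym path_rel_irrefl.
End PathGraph.

(** * Subdivisions and skeletons *)

(* When u -- v, the edge uv is replaced by the path u, None, v. *)
Section SubdivideEdge.
Variables (G : sgraph) (u v : G).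
Definition subdivide_rel : rel (option G) := fun a b =>
  match a, b with
  | Some x, Some y => (x -- y) && ([set x; y] != [set u; v])
  | Some x, None | None, Some x => x \in [set u; v]
  | None, None => false
  end.
Lemma subdivide_sym : symmetric subdivide_rel.
Proof. by case=> [x|] [y|] //=; rewrite edge_sym setUC. Qed.
Lemma subdivide_irrefl : irreflexive subdivide_rel.
Proof. by case=> [x|] //=; rewrite edge_irrefl. Qed.
Definition subdivide_edge : sgraph := SGraph subdivide_sym subdivide_irrefl.
End SubdivideEdge.

(* [subdivision H G]: G is a subdivision of H. *)
Inductive subdivision (H : sgraph) : sgraph -> Prop :=
| subdivision_iso (G : sgraph) : isomorphic H G -> subdivision H G
| subdivision_edge (G : sgraph) (u v : G) (G' : sgraph) :
    subdivision H G -> u -- v -> isomorphic (subdivide_edge u v) G' ->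
    subdivision H G'.

(* The skeleton is an edge-induced subgraph: a vertex of degree at least 3
   with no neighbour of degree at least 3 does not belong to it. *)
Section Skeleton.
Variable G : sgraph.
Definition skeleton_rel : rel G :=
  fun x y => [&& x -- y, 3 <= degree x & 3 <= degree y].
Definition skeleton_vertex : finType := {x : G | [exists y, skeleton_rel x y]}.
Definition skeleton_edge : rel skeleton_vertex :=
  fun x y => skeleton_rel (val x) (val y).
Lemma skeleton_sym : symmetric skeleton_edge.
Proof.
by move=> x y; rewrite /skeleton_edge /skeleton_rel edge_sym [(_ <= _) && _]andbC.
Qed.
Lemma skeleton_irrefl : irreflexive skeleton_edge.
Proof. by move=> x; rewrite /skeleton_edge /skeleton_rel edge_irrefl. Qed.
Definition skeleton : sgraph := SGraph skeleton_sym skeleton_irrefl.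
End Skeleton.

(* H is a K_4<S>. *)
Definition K4_with_skeleton (S H : sgraph) : Prop :=
  subdivision (complete 4) H /\ isomorphic (skeleton H) S.

Definition ASP (G : sgraph) : Prop :=
  (forall H, K4_with_skeleton (path_graph 3) H -> ~ subgraph H G) /\
  (forall H, K4_with_skeleton (path_graph 4) H -> ~ subgraph H G).

Definition proper_coloring (k : nat) (G : sgraph) (c : G -> 'I_k) : Prop :=
  forall x y : G, x -- y -> c x != c y.

(** * Polynomial time *)

(* The random access machines of Cook and Reckhow (Time bounded random access
   machines, 1973), except that registers hold natural numbers and subtraction
   is truncated.  Every instruction has unit cost.  As there is no
   multiplication, a step lengthens the largest number in the registers by at
   most one bit (unless it reads a larger input), so that polynomial time on
   these machines is polynomial time on Turing machines. *)
Inductive instr :=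
| IConst of nat & nat          (* IConst i c  : X_i <- c                   *)
| IAdd of nat & nat & nat      (* IAdd i j k  : X_i <- X_j + X_k           *)
| ISub of nat & nat & nat      (* ISub i j k  : X_i <- X_j - X_k           *)
| ILoad of nat & nat           (* ILoad i j   : X_i <- X_(X_j)             *)
| IStore of nat & nat          (* IStore i j  : X_(X_i) <- X_j             *)
| IJump of nat & nat           (* IJump l j   : go to line l if X_j > 0    *)
| IRead of nat                 (* IRead i     : X_i <- next input, or 0 if the
                                              input is exhausted         *)
| IPrint of nat.               (* IPrint i    : output X_i                 *)

Definition program := seq instr.

Record config := Config {
  pc : nat;
  reg : nat -> nat;
  input : seq nat;
  output : seq nat }.

Definition upd (m : nat -> nat) (i v : nat) : nat -> nat :=
  fun j => if j == i then v else m j.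

Definition exec (ins : instr) (s : config) : config :=
  let: Config l X x y := s in
  match ins with
  | IConst i c => Config l.+1 (upd X i c) x y
  | IAdd i j k => Config l.+1 (upd X i (X j + X k)) x y
  | ISub i j k => Config l.+1 (upd X i (X j - X k)) x y
  | ILoad i j => Config l.+1 (upd X i (X (X j))) x y
  | IStore i j => Config l.+1 (upd X (X i) (X j)) x y
  | IJump l' j => Config (if 0 < X j then l' else l.+1) X x y
  | IRead i => Config l.+1 (upd X i (head 0 x)) (behead x) y
  | IPrint i => Config l.+1 X x (rcons y (X i))
  end.

(* The machine halts by leaving the program; it then stays put. *)
Definition halted (p : program) (s : config) : bool := size p <= pc s.

Definition step (p : program) (s : config) : config :=
  if onth p (pc s) is Some ins then exec ins s else s.

Definition init (x : seq nat) : config := Config 0 (fun=> 0) x [::].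

(* On input x, the program p halts after at most t steps, with output y. *)
Definition computes_within (p : program) (x : seq nat) (t : nat) (y : seq nat)
    : Prop :=
  let s := iter t (step p) (init x) in halted p s /\ output s = y.

(* The number of vertices followed by the rows of the adjacency matrix. *)
Definition encode_graph (G : sgraph) : seq nat :=
  #|G| :: [seq nat_of_bool (x -- y) | x <- enum G, y <- enum G].

Definition encode_coloring (k : nat) (G : sgraph) (c : G -> 'I_k) : seq nat :=
  [seq val (c x) | x <- enum G].

(* A single program outputs a proper k-coloring of every graph of the class C,
   in time polynomial in the number of vertices (equivalently, in the size of
   the input). *)
Definition colorable_in_polynomial_time (k : nat) (C : sgraph -> Prop) : Prop :=
  exists (p : program) (a d : nat), forall G : sgraph, C G ->
    exists c : G -> 'I_k, proper_coloring c /\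
      computes_within p (encode_graph G) (a * #|G|.+1 ^ d) (encode_coloring c).

(* Main.v *)
Require Import Defs.
From mathcomp Require Import all_boot zify.

Set Implicit Arguments.
Unset Strict Implicit.
Unset Printing Implicit Defensive.

(** Write F for a subdivision of K4 on branch vertices a, b, c, d in which
    ab and bc are edges while ac, bd, ad are subdivided; cd is either.  Its
    skeleton is P3 or P4 according as cd is subdivided or an edge, so an
    almost series-parallel graph contains no F ([ASP_no_K4]).

    The heart of the proof is that a nonempty F-free graph of minimum degree
    at least 5 contains K6 ([mindeg5_K6]).  Take a longest path v_0 ... v_m;
    all the neighbors of v_0 lie on it.  If v_0 -- v_i, then rotating the path
    at i gives the path v_(i-1) ... v_0 v_i ... v_m, also longest, so the
    neighbors of v_(i-1) lie on it too.  When 3 <= i and v_0 has a neighbor v_l with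
    i + 2 <= l, the absence of F confines the neighbors of v_(i-1) to v_z with
    z <= i + 1 or z = l ([endpoint_nbrs]).  Among all longest paths choose one
    whose first vertex has its third neighbor, at index p, as early as
    possible.  After the rotation at p, the new first vertex has at least
    three neighbors of index at least p, and only p, p + 1 and l are
    available: its neighborhood is almost determined ([extremal_step]).  A few
    more copies of F then force l = p + 2 and p = 3, and v_0, ..., v_5 are
    pairwise adjacent ([extremal_K6]).

    Both hypotheses of the theorem pass to induced subgraphs, hence the graphs
    in question are 4-degenerate ([ASP_degenerate]): one can remove the
    vertices one at a time, each having at most 4 neighbors among those that
    remain, and then color them greedily with 5 colors in the reverse order.
    The program does this by brute force.  It keeps the adjacency matrix and
    one label per vertex: 0 for a vertex that is still present, 6 + j for the
    vertex removed in round j, and 1, ..., 5 for a color.  It is written in a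
    small structured language with do-while loops, whose compilation to the
    machine is proved correct together with running times
    ([runs_computes]), and takes O(n^3) steps on n vertices
    ([coloring_program_spec]). *)

(** * Isomorphisms and subgraphs *)

Lemma isomorphic_sym (G H : sgraph) : isomorphic G H -> isomorphic H G.
Proof.
case=> f [g fK gK] fE; exists g; first by exists f.
by move=> x y; rewrite -fE !gK.
Qed.

Lemma isomorphic_trans (G H K : sgraph) :
  isomorphic G H -> isomorphic H K -> isomorphic G K.
Proof.
case=> f fb fE [g gb gE]; exists (g \o f); first exact: bij_comp.
by move=> x y /=; rewrite gE fE.
Qed.

Lemma subdivision_trans_iso (H G G' : sgraph) :
  subdivision H G -> isomorphic G G' -> subdivision H G'.
Proof.
case=> [G1 i1|G1 u v G2 s1 uv i1] i2.
  exact/subdivision_iso/(isomorphic_trans i1 i2).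
exact: subdivision_edge s1 uv (isomorphic_trans i1 i2).
Qed.

Lemma subgraph_trans (H G K : sgraph) :
  subgraph H G -> subgraph G K -> subgraph H K.
Proof.
case=> f fi fE [g gi gE]; exists (g \o f); first exact: inj_comp.
by move=> x y /fE /gE.
Qed.

Lemma inj_surj_bij (A B : finType) (f : A -> B) :
  injective f -> (forall y, exists x, y = f x) -> bijective f.
Proof.
move=> finj fsurj; apply: inj_card_bij => //.
rewrite -(card_codom finj) subset_leq_card //.
by apply/subsetP => y _; have [x ->] := fsurj y; apply: codom_f.
Qed.

(** * Graphs given by lists of edges *)

Section EdgeLists.
Variable T : finType.
Implicit Types (x y u v w : T) (p : seq T) (E : seq (T * T)).

Definition ends E : seq T := unzip1 E ++ unzip2 E.

Definition edge_rel E : rel T :=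
  fun x y => (x != y) && (((x, y) \in E) || ((y, x) \in E)).

Lemma mem_ends x E : reflect (exists2 e, e \in E & (x == e.1) || (x == e.2))
                             (x \in ends E).
Proof.
apply: (iffP idP) => [|[e eE]].
  rewrite mem_cat => /orP[] /mapP[e eE ->]; exists e => //; rewrite eqxx //.
  by rewrite orbT.
rewrite mem_cat => /orP[] /eqP->; apply/orP; [left|right]; exact: map_f.
Qed.

Lemma endsP1 E x y : (x, y) \in E -> x \in ends E.
Proof. by move=> h; apply/mem_ends; exists (x, y); rewrite ?eqxx. Qed.

Lemma endsP2 E x y : (x, y) \in E -> y \in ends E.
Proof. by move=> h; apply/mem_ends; exists (x, y); rewrite ?eqxx ?orbT. Qed.

Definition edges_vertex E : finType := {x : T | x \in ends E}.

Definition edges_rel E : rel (edges_vertex E) :=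
  fun a b => edge_rel E (val a) (val b).

Lemma edges_sym E : symmetric (@edges_rel E).
Proof. by move=> a b; rewrite /edges_rel /edge_rel eq_sym orbC. Qed.

Lemma edges_irrefl E : irreflexive (@edges_rel E).
Proof. by move=> x; rewrite /edges_rel /edge_rel eqxx. Qed.

Definition edges_graph E : sgraph := SGraph (@edges_sym E) (@edges_irrefl E).

Lemma edges_graph_eq E E' : E =i E' ->
  isomorphic (edges_graph E) (edges_graph E').
Proof.
move=> eqE; have eqr x y : edge_rel E x y = edge_rel E' x y.
  by rewrite /edge_rel !eqE.
have eqe x : (x \in ends E) = (x \in ends E').
  by apply/mem_ends/mem_ends => -[e]; rewrite ?eqE -?eqE => eE h; exists e;
     rewrite // ?eqE // -eqE.
pose f (x : edges_graph E) : edges_graph E' :=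
  exist _ (val x) (etrans (esym (eqe _)) (valP x)).
pose g (x : edges_graph E') : edges_graph E :=
  exist _ (val x) (etrans (eqe _) (valP x)).
exists f; first by exists g => x; exact: val_inj.
by move=> x y; rewrite /= /edges_rel /= eqr.
Qed.

(** The vertex None of [subdivide_edge] becomes w; the inverse map is insub,
    which sends to None exactly the element w outside the old vertex set. *)
Lemma edges_graph_subdivide u v w E :
    u != v -> w \notin ends ((u, v) :: E) ->
    (u, v) \notin E -> (v, u) \notin E ->
  forall H, subdivision H (edges_graph ((u, v) :: E)) ->
  subdivision H (edges_graph ((u, w) :: (w, v) :: E)).
Proof.
move=> uv wE uvE vuE H sH.
set E1 := (u, v) :: E in wE sH *; set E2 := [:: (u, w), (w, v) & E].
have uE1 : u \in ends E1 by apply: (@endsP1 _ _ v); rewrite mem_head.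
have vE1 : v \in ends E1 by apply: (@endsP2 _ u); rewrite mem_head.
have uw : u != w by apply: contraNneq wE => <-.
have vw : v != w by apply: contraNneq wE => <-.
have wE2 : w \in ends E2 by apply: (@endsP2 _ u); rewrite mem_head.
have sub12 x : x \in ends E1 -> x \in ends E2.
  move=> /mem_ends[e]; rewrite inE => /orP[/eqP->/orP[]/eqP->|eE ex].
  - by apply: (@endsP1 _ _ w); rewrite mem_head.
  - by apply: (@endsP2 _ w); rewrite !inE eqxx orbT.
  - by apply/mem_ends; exists e; rewrite // !inE eE !orbT.
have sub21 x : x \in ends E2 -> x != w -> x \in ends E1.
  move=> /mem_ends[e eE2]; move: eE2.
  rewrite in_cons in_cons => /or3P[/eqP->|/eqP->|eE].
  - by case/orP => /eqP->; rewrite // eqxx.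
  - by case/orP => /eqP->; rewrite // eqxx.
  by move=> ex _; apply/mem_ends; exists e; rewrite // inE eE orbT.
have ne_w (x : edges_graph E1) : val x != w.
  by apply: contraNneq wE => <-; exact: valP.
pose u1 : edges_graph E1 := exist _ u uE1.
pose v1 : edges_graph E1 := exist _ v vE1.
apply: (@subdivision_edge _ (edges_graph E1) u1 v1) => //.
  by rewrite /edge /= /edges_rel /edge_rel /= uv mem_head.
pose f (o : subdivide_edge u1 v1) : edges_graph E2 :=
  if o is Some x then exist _ (val x) (sub12 _ (valP x)) else exist _ w wE2.
pose g (y : edges_graph E2) : subdivide_edge u1 v1 := insub (val y).
exists f.
  exists g.
  - case=> [x|]; rewrite /g /f /=; first by rewrite valK.
    by rewrite insubN.
  - move=> y; rewrite /g; case: insubP => [x _ xy|yE].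
      by apply: val_inj; rewrite /= xy.
    apply: val_inj => /=; apply/eqP; rewrite eq_sym.
    by apply: contraNT yE => yw; apply: sub21 => //; exact: valP.
have wNE x : ((x, w) \in E) = false.
  apply: contraNF wE => h; apply: (@endsP2 _ x).
  by rewrite inE h orbT.
have wNE' x : ((w, x) \in E) = false.
  apply: contraNF wE => h; apply: (@endsP1 _ _ x).
  by rewrite inE h orbT.
case=> [x|] [y|]; rewrite /= /edge /= /edges_rel /edge_rel /=.
- have -> : ([set x; y] == [set u1; v1]) =
     ((val x == u) && (val y == v)) || ((val x == v) && (val y == u)).
    apply/eqP/idP => [e|].
      have := set21 x y; have := set22 x y; rewrite e !inE.
      have := set21 u1 v1; have := set22 u1 v1; rewrite -e !inE.
      rewrite -!(inj_eq val_inj) /= ![u == _]eq_sym ![v == _]eq_sym.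
      case: (sval x =P u) => [->|_]; case: (sval y =P u) => [->|_] //=;
        rewrite ?(negPf uv) ?eqxx ?orbT //=.
      by rewrite orbF.
    case/orP => /andP[/eqP xu /eqP yv]; apply/setP => z;
      rewrite !inE -!(inj_eq val_inj) /= xu yv //.
    by rewrite orbC.
  rewrite !inE !xpair_eqE /= (negPf (ne_w x)) (negPf (ne_w y)) /= !andbF /=.
  case: (sval x =P u) => [->|xu]; case: (sval y =P v) => [->|yv];
    rewrite ?(negPf uvE) ?(negPf vuE) ?orbF ?orbT ?andbF ?andbT //=.
  + case: (sval y =P u) => [->|yu]; rewrite ?eqxx ?(negPf uv) ?andbF ?andbT //=.
  + case: (sval x =P v) => [->|xv]; rewrite ?eqxx ?andbF ?andbT //=.
  + case: (sval x =P v) => [->|xv]; case: (sval y =P u) => [->|yu];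
      by rewrite /= ?(negPf uvE) ?(negPf vuE) ?andbF ?andbT.
- rewrite !inE !xpair_eqE eqxx wNE wNE' -!(inj_eq val_inj) /= (ne_w x).
  rewrite (negPf (ne_w x)) [w == v]eq_sym [w == u]eq_sym (negPf vw) (negPf uw).
  by rewrite /= ?andbT ?andbF ?orbF.
- rewrite !inE !xpair_eqE eqxx wNE wNE' -!(inj_eq val_inj) /= eq_sym (ne_w y).
  rewrite (negPf (ne_w y)) [w == v]eq_sym [w == u]eq_sym (negPf vw) (negPf uw).
  by rewrite /= ?andbT ?andbF ?orbF orbC.
- by rewrite eqxx.
Qed.

Fixpoint path_edges u p v : seq (T * T) :=
  if p is w :: p' then (u, w) :: path_edges w p' v else [:: (u, v)].

Lemma ends_cat E1 E2 x :
  (x \in ends (E1 ++ E2)) = (x \in ends E1) || (x \in ends E2).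
Proof.
by rewrite /ends /unzip1 /unzip2 !map_cat !mem_cat orbACA.
Qed.

Lemma ends_cons u v E x :
  (x \in ends ((u, v) :: E)) = [|| x == u, x == v | x \in ends E].
Proof.
by rewrite -cat1s ends_cat /ends /= !inE orbA.
Qed.

Lemma path_edges_mem u p v x y : (x, y) \in path_edges u p v ->
  (x \in u :: p) /\ (y \in v :: p).
Proof.
elim: p u => [|w p IH] u /=.
  by rewrite !inE => /eqP[-> ->]; rewrite !eqxx.
rewrite inE => /orP[/eqP[-> ->]|/IH[]]; first by rewrite !inE !eqxx orbT.
rewrite !inE => h1 h2; split; first by rewrite h1 orbT.
by case/orP: h2 => ->; rewrite ?orbT.
Qed.

Lemma path_edges_inner u p v x y : p != [::] -> (x, y) \in path_edges u p v ->
  (x \in p) || (y \in p).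
Proof.
case: p => // w p _ /=; rewrite inE => /orP[/eqP[_ ->]|/path_edges_mem[-> _]//].
by rewrite mem_head orbT.
Qed.

Lemma path_edges_edge (e : rel T) u p v x y : path e u (rcons p v) ->
  (x, y) \in path_edges u p v -> e x y.
Proof.
elim: p u => [|w p IH] u /=; first by rewrite andbT inE => h /eqP[-> ->].
by case/andP => uw /IH IHp; rewrite inE => /orP[/eqP[-> ->]|].
Qed.

Lemma path_edges_first u p v : (u, head v p) \in path_edges u p v.
Proof. by case: p => [|w p]; rewrite mem_head. Qed.

Lemma path_edges_last u p v : (last u p, v) \in path_edges u p v.
Proof.
by elim: p u => [|w p IH] u /=; rewrite ?mem_head // inE IH orbT.
Qed.

Lemma ends_path_edges u p v x :
  (x \in ends (path_edges u p v)) = (x \in [:: u, v & p]).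
Proof.
elim: p u => [|w p IH] u; first by rewrite /ends.
rewrite /= ends_cons IH !inE.
by case: (x == u); case: (x == v); case: (x == w); rewrite ?orbT.
Qed.

(** A whole path is obtained by subdividing one edge repeatedly, always the
    edge that is incident with v. *)
Lemma subdivision_path (H : sgraph) u v p E1 E2 :
    subdivision H (edges_graph (E1 ++ (u, v) :: E2)) -> uniq [:: u, v & p] ->
    {in p, forall x, x \notin ends (E1 ++ E2)} ->
    (u, v) \notin E1 ++ E2 -> (v, u) \notin E1 ++ E2 ->
  subdivision H (edges_graph (E1 ++ path_edges u p v ++ E2)).
Proof.
move=> sH Up pE uvE vuE.
suff: subdivision H (edges_graph (path_edges u p v ++ (E1 ++ E2))).
  move=> h; apply: (subdivision_trans_iso h); apply: edges_graph_eq => x.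
  by rewrite !mem_cat orbCA.
have {sH}: subdivision H (edges_graph ((u, v) :: (E1 ++ E2))).
  apply: (subdivision_trans_iso sH); apply: edges_graph_eq => x.
  by rewrite in_cons !mem_cat in_cons orbCA.
move: (E1 ++ E2) pE uvE vuE => E.
elim: p u E Up => [//|w p IH] u E Up pE uvE vuE sH.
have wE : w \notin ends E by apply: pE; rewrite mem_head.
move: Up; rewrite /= !inE !negb_or.
move=> /and4P[/and3P[uv uw up] /andP[vw vp] wp Up].
have {}sH : subdivision H (edges_graph ((w, v) :: (u, w) :: E)).
  apply: subdivision_trans_iso (edges_graph_subdivide (w := w) uv _ uvE vuE sH) _.
    by rewrite ends_cons ![w == _]eq_sym (negPf uw) (negPf vw).
  by apply: edges_graph_eq => x; rewrite !inE orbCA.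
have := IH w ((u, w) :: E).
move/(_ _ _ _ _ sH) => h; apply: (subdivision_trans_iso (h _ _ _ _)).
- by rewrite /= !inE negb_or eq_sym vw wp vp Up.
- move=> x xp; rewrite ends_cons !negb_or.
  rewrite pE ?inE ?xp ?orbT // andbT.
  by rewrite (memPn up) ?(memPn wp).
- rewrite inE negb_or xpair_eqE negb_and eq_sym uw /=.
  by apply: contraNN wE => /endsP1.
- rewrite inE negb_or xpair_eqE [v == u]eq_sym (negPf uv) /=.
  by apply: contraNN wE => /endsP2.
- by apply: edges_graph_eq => x; rewrite !(inE, mem_cat) orbCA.
Qed.

(** The degree in the multigraph with edge list E, a loop counting twice.
    Unlike [degree] it is additive in E, and it bounds [degree] above. *)
Definition incidence E x := \sum_(e <- E) ((e.1 == x) + (e.2 == x)).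

Lemma incidence_path u p v x :
  incidence (path_edges u p v) x
    = (u == x) + (v == x) + 2 * count_mem x p.
Proof.
rewrite /incidence; elim: p u => [|w p IH] u /=.
  by rewrite big_seq1 muln0 addn0.
by rewrite big_cons IH /=; lia.
Qed.

Lemma incidence_cat E1 E2 x :
  incidence (E1 ++ E2) x = incidence E1 x + incidence E2 x.
Proof. exact: big_cat. Qed.

Lemma degree_le_incidence E (x : edges_graph E) :
  degree x <= incidence E (val x).
Proof.
pose s := [seq e.2 | e <- E & e.1 == val x] ++ [seq e.1 | e <- E & e.2 == val x].
have <- : size s = incidence E (val x).
  rewrite size_cat !size_map !size_filter /incidence big_split /=.
  by rewrite -!big_mkcond !sum1_count.
rewrite /degree cardE -(size_map val); apply: uniq_leq_size.
  by rewrite (map_inj_uniq val_inj) enum_uniq.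
move=> z /mapP[y]; rewrite mem_enum inE => xy ->.
case/andP: xy => _ /orP[]h; rewrite mem_cat; apply/orP; [left|right].
  by apply/mapP; exists (val x, val y); rewrite // mem_filter eqxx.
by apply/mapP; exists (val y, val x); rewrite // mem_filter eqxx.
Qed.

Lemma degree_ge3 E (x : edges_graph E) y1 y2 y3 :
    uniq [:: val x; y1; y2; y3] ->
    {in [:: y1; y2; y3], forall y, ((val x, y) \in E) || ((y, val x) \in E)} ->
  3 <= degree x.
Proof.
move=> /andP[xy Uy] yE; rewrite /degree cardE -(size_map val).
apply: (@uniq_leq_size _ [:: y1; y2; y3]) => // y yy.
have yEnd : y \in ends E.
  by case/orP: (yE _ yy) => [/endsP2|/endsP1].
apply/mapP; exists (exist _ y yEnd : edges_graph E) => //.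
rewrite mem_enum inE /edge /= /edges_rel /edge_rel /= yE // andbT.
by rewrite eq_sym (memPn xy).
Qed.

End EdgeLists.

Lemma skeleton_path_iso (H : sgraph) k (t : 'I_k.+2 -> H) :
    injective t -> (forall i j, skeleton_rel (t i) (t j) = path_rel i j) ->
    (forall x y : H, skeleton_rel x y -> exists i, x = t i) ->
  isomorphic (skeleton H) (path_graph k.+2).
Proof.
move=> tinj tE tsurj; apply: isomorphic_sym.
have tP i : [exists y, skeleton_rel (t i) y].
  case: (unliftP ord0 i) => [j ->|->]; apply/existsP.
    have jk : j < k.+2 by apply: ltnW; rewrite ltnS ltn_ord.
    by exists (t (Ordinal jk)); rewrite tE /path_rel /= /bump /= add1n eqxx orbT.
  by exists (t (lift ord0 ord0)); rewrite tE.
pose f i : skeleton H := exist _ (t i) (tP i).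
exists f; last by move=> i j; rewrite /edge /= /skeleton_edge tE.
apply: inj_surj_bij => [i j [/tinj]//|[x xP]].
have /existsP[y /tsurj[i xi]] := xP.
by exists i; apply: val_inj.
Qed.

(** * Subdivisions of K4 in almost series-parallel graphs *)

(** Distinctness of two vertices of the configuration below reduces to that
    of the positions of their blocks. *)
Lemma uniq_flatten_index (T : eqType) (ss : seq (seq T)) i j x :
  uniq (flatten ss) -> x \in nth [::] ss i -> x \in nth [::] ss j -> i = j.
Proof.
elim: ss i j => [|s ss IH] i j; first by rewrite !nth_nil.
rewrite /= cat_uniq => /and3P[_ /hasPn dis U].
have in_ss k : x \in nth [::] ss k -> x \in flatten ss.
  move=> xk; apply/flattenP; exists (nth [::] ss k) => //; apply: mem_nth.
  by rewrite ltnNge; apply: contraL xk => /(nth_default [::])->.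
case: i j => [|i] [|j] //=.
- by move=> xs /in_ss/dis; rewrite /= xs.
- by move=> /in_ss/dis/negP.
- by move=> xi xj; rewrite (IH i j).
Qed.

(** The branch vertices are a, b, c, d, and p, q, r, s are the inner vertices
    of the paths ac, bd, ad, cd. *)
Section K4.
Variables (G : sgraph) (a b c d : G) (p q r s : seq G).
Let blocks := [:: [:: a]; [:: b]; [:: c]; [:: d]; p; q; r; s].
Hypothesis U : uniq (flatten blocks).
Hypotheses (p0 : p != [::]) (q0 : q != [::]) (r0 : r != [::]).

Let K := path_edges a p c ++ path_edges b q d ++ path_edges a r d
         ++ path_edges c s d ++ [:: (a, b); (b, c)].

Let neq i j x y : i != j -> x \in nth [::] blocks i -> y \in nth [::] blocks j ->
  x != y.
Proof.
move=> ij xi yj; apply: contraNneq ij => xy.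
by apply/eqP/(uniq_flatten_index U xi); rewrite xy.
Qed.

Let ab : a != b. Proof. by apply: (@neq 0 1); rewrite ?mem_head. Qed.
Let ac : a != c. Proof. by apply: (@neq 0 2); rewrite ?mem_head. Qed.
Let ad : a != d. Proof. by apply: (@neq 0 3); rewrite ?mem_head. Qed.
Let bc : b != c. Proof. by apply: (@neq 1 2); rewrite ?mem_head. Qed.
Let bd : b != d. Proof. by apply: (@neq 1 3); rewrite ?mem_head. Qed.
Let cd : c != d. Proof. by apply: (@neq 2 3); rewrite ?mem_head. Qed.

Let branch := [:: a; b; c; d].

Let branchN x i : x \in branch -> (x \in nth [::] blocks i.+4) = false.
Proof.
move=> xB; apply/negP => xi.
suff [k kx k4] : exists2 k, x \in nth [::] blocks k & k < 4.
  by rewrite (uniq_flatten_index U kx xi) in k4.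
by move: xB; rewrite !inE => /or4P[]/eqP->; [exists 0|exists 1|exists 2|exists 3];
  rewrite ?mem_head.
Qed.

Let tE := (negPf ab, negPf ac, negPf ad, negPf bc, negPf bd, negPf cd).
Let tE' : ((b == a) = false) * ((c == a) = false) * ((d == a) = false)
  * ((c == b) = false) * ((d == b) = false) * ((d == c) = false).
Proof. by do !split; rewrite eq_sym !tE. Qed.
Let neqE := (tE, tE').

Let t (i : 'I_4) : G := nth a branch i.
Let t_inj : injective t.
Proof.
move=> i j ij; apply: val_inj; apply/eqP; rewrite -(@nth_uniq _ a branch) ?ltn_ord //.
  exact/eqP.
by rewrite /= !inE !neqE.
Qed.

Lemma subdivision_K4_base :
  subdivision (complete 4)
   (edges_graph [:: (a, c); (b, d); (a, d); (c, d); (a, b); (b, c)]).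
Proof.
set E := (X in edges_graph X).
have endsE x : (x \in ends E) = (x \in branch).
  rewrite !ends_cons /ends /= !inE.
  by case: (x == a); case: (x == b); case: (x == c); case: (x == d).
have tEnd i : t i \in ends E by rewrite endsE mem_nth.
apply: subdivision_iso; exists (fun i => exist _ (t i) (tEnd i) : edges_graph E).
  apply: inj_surj_bij => [i j [/t_inj]//|[x xE]].
  have xb : x \in branch by rewrite -endsE.
  have x4 : index x branch < 4 by rewrite -[4]/(size branch) index_mem.
  by exists (Ordinal x4); apply: val_inj; rewrite /= /t nth_index.
move=> i j; rewrite /edge /= /edges_rel /edge_rel /complete_rel /=.
rewrite (inj_eq t_inj) andb_idr // => ij.
rewrite !inE !xpair_eqE.
case: i j ij => [[|[|[|[|i]]]] //= i4] [[|[|[|[|j]]]] //= j4] //= _;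
  by rewrite /t /= ?eqxx ?orbT.
Qed.

Let inner_uniq k : uniq (nth [::] blocks k).
Proof.
have [k8|k8] := ltnP k (size blocks); last by rewrite nth_default.
move: U; elim: blocks k k8 => // s' ss IH [_|k k8] /=; rewrite cat_uniq.
  by case/andP.
by case/and3P => _ _ /(IH k k8).
Qed.

Let branch_edge x y u v k : x \in branch -> y \in branch ->
  ((x, y) \in path_edges u (nth [::] blocks k.+4) v) =
  [&& nth [::] blocks k.+4 == [::], x == u & y == v].
Proof.
move=> xB yB; have xN := branchN k xB; have yN := branchN k yB.
apply/idP/and3P => [xy|[/eqP-> /eqP-> /eqP->]]; last exact: mem_head.
have [] := path_edges_mem xy; rewrite !inE xN yN !orbF; split=> //.
by apply: contraLR xy => l0; apply/negP => /(path_edges_inner l0);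
  rewrite xN yN.
Qed.

Let innerN k x : x \in nth [::] blocks k.+4 ->
  ((x == a) = false) * ((x == b) = false) * ((x == c) = false)
  * ((x == d) = false).
Proof.
move=> xk; have N y : y \in branch -> (x == y) = false.
  by move=> yB; apply: contraTF xk => /eqP->; rewrite branchN.
by rewrite !N ?inE ?eqxx ?orbT.
Qed.

Let innerNN k l x : x \in nth [::] blocks k.+4 -> k != l ->
  (x \in nth [::] blocks l.+4) = false.
Proof.
move=> xk; apply: contraNF => xl.
by have /eqP := uniq_flatten_index U xk xl.
Qed.

Let aB : a \in branch. Proof. by rewrite !inE eqxx. Qed.
Let bB : b \in branch. Proof. by rewrite !inE eqxx orbT. Qed.
Let cB : c \in branch. Proof. by rewrite !inE eqxx !orbT. Qed.
Let dB : d \in branch. Proof. by rewrite !inE eqxx !orbT. Qed.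

Let edge_p x y u v : x \in branch -> y \in branch ->
  ((x, y) \in path_edges u p v) = false.
Proof. by move=> xB yB; rewrite (branch_edge u v 0) //= (negPf p0). Qed.
Let edge_q x y u v : x \in branch -> y \in branch ->
  ((x, y) \in path_edges u q v) = false.
Proof. by move=> xB yB; rewrite (branch_edge u v 1) //= (negPf q0). Qed.
Let edge_r x y u v : x \in branch -> y \in branch ->
  ((x, y) \in path_edges u r v) = false.
Proof. by move=> xB yB; rewrite (branch_edge u v 2) //= (negPf r0). Qed.
Let edge_s x y u v : x \in branch -> y \in branch ->
  ((x, y) \in path_edges u s v) = [&& s == [::], x == u & y == v].
Proof. exact: (branch_edge u v 3). Qed.
Let edgeE := (edge_p, edge_q, edge_r, edge_s).

Let endsE := (ends_cat, ends_path_edges, ends_cons).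

Lemma subdivision_K4 : subdivision (complete 4) (edges_graph K).
Proof.
have step k u v E1 E2 : u \in branch -> v \in branch -> u != v ->
    {in nth [::] blocks k.+4, forall x, x \notin ends (E1 ++ E2)} ->
    (u, v) \notin E1 ++ E2 -> (v, u) \notin E1 ++ E2 ->
    subdivision (complete 4) (edges_graph (E1 ++ (u, v) :: E2)) ->
  subdivision (complete 4)
    (edges_graph (E1 ++ path_edges u (nth [::] blocks k.+4) v ++ E2)).
  move=> uB vB uv xE uvE vuE /subdivision_path; apply=> //.
  by rewrite 2!cons_uniq in_cons negb_or uv !branchN //; exact: (inner_uniq k.+4).
rewrite /K [_ ++ _ ++ path_edges a r d ++ _]catA catA.
apply: (step 3) => //.
- move=> x xs; rewrite !endsE !inE !(innerN xs) /=.
  by rewrite (innerNN (l := 0) xs) // (innerNN (l := 1) xs) // (innerNN (l := 2) xs).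
- by rewrite !mem_cat !edgeE // !inE !xpair_eqE !neqE ?andbF.
- by rewrite !mem_cat !edgeE // !inE !xpair_eqE !neqE ?andbF.
rewrite -catA; apply: (step 2) => //.
- move=> x xs; rewrite !endsE !inE !(innerN xs) /=.
  by rewrite (innerNN (l := 0) xs) // (innerNN (l := 1) xs).
- by rewrite !mem_cat !edgeE // !inE !xpair_eqE !neqE ?andbF.
- by rewrite !mem_cat !edgeE // !inE !xpair_eqE !neqE ?andbF.
rewrite -catA; apply: (step 1) => //.
- move=> x xs; rewrite !endsE !inE !(innerN xs) /=.
  by rewrite (innerNN (l := 0) xs).
- by rewrite !mem_cat !edgeE // !inE !xpair_eqE !neqE ?andbF.
- by rewrite !mem_cat !edgeE // !inE !xpair_eqE !neqE ?andbF.
apply: (step 0 _ _ [::]) => //; last exact: subdivision_K4_base.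
- by move=> x xs; rewrite !endsE /= !(innerN (k := 0) xs).
- by rewrite cat0s !inE !xpair_eqE !neqE ?andbF.
- by rewrite cat0s !inE !xpair_eqE !neqE ?andbF.
Qed.

Let edgeK x y : x \in branch -> y \in branch ->
  ((x, y) \in K) =
  [|| [&& s == [::], x == c & y == d], (x == a) && (y == b)
    | (x == b) && (y == c)].
Proof. by move=> xB yB; rewrite !mem_cat !edgeE // !inE !xpair_eqE. Qed.

Let endsK x : (x \in ends K) = (x \in flatten blocks).
Proof.
rewrite !endsE /ends /= !inE !mem_cat.
by do 4![case: (x == _) => //=]; rewrite ?orbT ?orbF.
Qed.

Let branch_flatten x : x \in branch -> x \in flatten blocks.
Proof.
move=> xB; suff: x \in branch ++ flatten [:: p; q; r; s] by [].
by rewrite mem_cat xB.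
Qed.

Let degree_le2 (x : edges_graph K) : val x \notin branch -> degree x <= 2.
Proof.
move=> xB; apply: leq_trans (degree_le_incidence _) _.
have : count_mem (val x) (flatten blocks) <= 1.
  by rewrite count_uniq_mem // leq_b1.
rewrite !incidence_cat !incidence_path /incidence !big_cons big_nil /=.
rewrite !count_cat /= !(eq_sym _ (val x)).
move: xB; rewrite !inE !negb_or => /and4P[/negPf-> /negPf-> /negPf-> /negPf->].
by move: (count_mem _ p) (count_mem _ q) (count_mem _ r) (count_mem _ s);
  clear; lia.
Qed.

(** Each branch vertex is adjacent to the first vertex of each of the three
    paths that leave it.  The path cd may have no inner vertex, so its first
    vertex seen from either end lies in one of two blocks. *)
Let degree_ge3_branch (x : edges_graph K) : val x \in branch -> 3 <= degree x.
Proof.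
have [fp lp] : head c p \in p /\ last a p \in p.
  by case: (p) p0 => // z l _; rewrite mem_head /= mem_last.
have [fq lq] : head d q \in q /\ last b q \in q.
  by case: (q) q0 => // z l _; rewrite mem_head /= mem_last.
have [fr lr] : head d r \in r /\ last a r \in r.
  by case: (r) r0 => // z l _; rewrite mem_head /= mem_last.
have [k ks fs] : exists2 k, (k == 3) || (k == 7) &
    head d s \in nth [::] blocks k.
  have [->|hs] : head d s = d \/ head d s \in s.
  - by case: (s) => [|z l]; [left|right; apply: mem_head].
  - by exists 3; rewrite ?mem_head.
  by exists 7.
have [l ls hs] : exists2 k, (k == 2) || (k == 7) &
    last c s \in nth [::] blocks k.
  have [->|hs] : last c s = c \/ last c s \in s.
  - by case: (s) => [|z l]; [left|right; apply: (mem_last z l)].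
  - by exists 2; rewrite ?mem_head.
  by exists 7.
have Kp e : e \in path_edges a p c -> e \in K by rewrite !mem_cat => ->.
have Kq e : e \in path_edges b q d -> e \in K.
  by rewrite !mem_cat => ->; rewrite ?orbT.
have Kr e : e \in path_edges a r d -> e \in K.
  by rewrite !mem_cat => ->; rewrite ?orbT.
have Ks e : e \in path_edges c s d -> e \in K.
  by rewrite !mem_cat => ->; rewrite ?orbT.
have Kab : (a, b) \in K by rewrite !mem_cat mem_head !orbT.
have Kbc : (b, c) \in K by rewrite !mem_cat !inE eqxx !orbT.
have N i j y z : y \in nth [::] blocks i -> z \in nth [::] blocks j ->
    i != j -> y != z by move=> *; exact: (@neq i j).
have Na i y := N 0 i a y (mem_head _ _).
have Nb i y := N 1 i b y (mem_head _ _).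
have Nc i y := N 2 i c y (mem_head _ _).
have Nd i y := N 3 i d y (mem_head _ _).
rewrite !inE => /or4P[] /eqP xE.
- apply: (@degree_ge3 _ _ _ b (head c p) (head d r)); rewrite xE.
    rewrite /= !inE !negb_or ab (Na 4) // (Na 6) // (Nb 4) // (Nb 6) //.
    by rewrite (N 4 6).
  move=> y; rewrite !inE => /or3P[]/eqP->; first by rewrite Kab.
    by rewrite Kp // path_edges_first.
  by rewrite Kr // path_edges_first.
- apply: (@degree_ge3 _ _ _ a c (head d q)); rewrite xE.
    rewrite /= !inE !negb_or eq_sym ab bc ac (Nb 5) // (Na 5) //.
    by rewrite (Nc 5).
  move=> y; rewrite !inE => /or3P[]/eqP->; first by rewrite Kab orbT.
    by rewrite Kbc.
  by rewrite Kq // path_edges_first.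
- apply: (@degree_ge3 _ _ _ b (last a p) (head d s)); rewrite xE.
    rewrite /= !inE !negb_or eq_sym bc (Nc 4) // (Nb 4) //.
    by rewrite (Nc k) ?(Nb k) ?(N 4 k) //; case/orP: ks => /eqP->.
  move=> y; rewrite !inE => /or3P[]/eqP->; first by rewrite Kbc orbT.
    by rewrite orbC Kp // path_edges_last.
  by rewrite Ks // path_edges_first.
- apply: (@degree_ge3 _ _ _ (last b q) (last a r) (last c s)); rewrite xE.
    rewrite /= !inE !negb_or (Nd 5) // (Nd 6) // (Nd l) //.
      by rewrite (N 5 6) // (N 5 l) ?(N 6 l) //; case/orP: ls => /eqP->.
    by case/orP: ls => /eqP->.
  move=> y; rewrite !inE => /or3P[]/eqP->; apply/orP; right.
  + by rewrite Kq // path_edges_last.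
  + by rewrite Kr // path_edges_last.
  + by rewrite Ks // path_edges_last.
Qed.

Let skeletonE (x y : edges_graph K) : skeleton_rel x y =
  [&& val x \in branch, val y \in branch & edge_rel K (val x) (val y)].
Proof.
have deg (z : edges_graph K) : (3 <= degree z) = (val z \in branch).
  by apply/idP/idP => [|/degree_ge3_branch//]; apply: contraLR => /degree_le2;
    rewrite -leqNgt.
by rewrite /skeleton_rel !deg andbC -andbA.
Qed.

Let tB i : t i \in branch. Proof. by rewrite mem_nth. Qed.

Let branch_vertex (i : 'I_4) : edges_graph K :=
  exist _ (t i) (etrans (endsK _) (branch_flatten (tB i))).

Let branch_vertex_inj : injective branch_vertex.
Proof. by move=> i j [/t_inj]. Qed.

Let branch_vertex_surj (x : edges_graph K) :
  val x \in branch -> exists i, x = branch_vertex i.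
Proof.
move=> xB; have x4 : index (val x) branch < 4 by rewrite -[4]/(size branch) index_mem.
by exists (Ordinal x4); apply: val_inj; rewrite /= /t nth_index.
Qed.

(** By the degrees, the skeleton consists of the edges that join two branch
    vertices: ab, bc, and also cd if s is empty. *)
Lemma skeleton_K4 : isomorphic (skeleton (edges_graph K)) (path_graph 3) \/
  isomorphic (skeleton (edges_graph K)) (path_graph 4).
Proof.
have [s0|s0] := altP (s =P [::]); [right|left].
  apply: (skeleton_path_iso branch_vertex_inj) => [i j|x y]; last first.
    by rewrite skeletonE => /and3P[/branch_vertex_surj].
  rewrite skeletonE /= !tB /edge_rel !edgeK // s0 /= (inj_eq t_inj).
  case: i j => [[|[|[|[|i]]]] //= i4] [[|[|[|[|j]]]] //= j4];
    by rewrite /t /path_rel /= ?eqxx ?neqE ?andbF.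
pose w3 := widen_ord (isT : 3 <= 4).
have w3_inj : injective w3 by move=> i j [/val_inj].
apply: (skeleton_path_iso (inj_comp branch_vertex_inj w3_inj)) => [i j|x y].
  rewrite skeletonE /= !tB /edge_rel !edgeK // (negPf s0) /= (inj_eq t_inj).
  case: i j => [[|[|[|i]]] //= i4] [[|[|[|j]]] //= j4];
    by rewrite /t /path_rel /= ?eqxx ?neqE ?andbF.
rewrite skeletonE => /and3P[/branch_vertex_surj[i ->] yB] /andP[_].
rewrite /= !edgeK ?tB // (negPf s0) /= => xy.
have i3 : i < 3.
  case: i xy => [[|[|[|[|i]]]] //= i4].
  by rewrite /t /= ?neqE ?andbF.
by exists (Ordinal i3); congr branch_vertex; apply: val_inj.
Qed.

(** Leaving s unconstrained merges the two excluded skeletons into a single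
    forbidden configuration. *)
Lemma ASP_no_K4 :
    ASP G -> path (@edge G) a (rcons p c) -> path (@edge G) b (rcons q d) ->
    path (@edge G) a (rcons r d) -> path (@edge G) c (rcons s d) ->
    a -- b -> b -- c ->
  False.
Proof.
move=> [noP3 noP4] Pp Pq Pr Ps Eab Ebc.
have sub : subgraph (edges_graph K) G.
  exists val => [|x y]; first exact: val_inj.
  have KE e : e \in K -> e.1 -- e.2.
    case: e => y1 y2; rewrite !mem_cat => /or4P[|||/orP[]].
    - exact: path_edges_edge.
    - exact: path_edges_edge.
    - exact: path_edges_edge.
    - exact: path_edges_edge.
    by rewrite !inE => /orP[]/eqP[-> ->].
  by case/andP => _ /orP[/KE//|/KE]; rewrite /= edge_sym.
have K4 := subdivision_K4.
by case: skeleton_K4 => iso; [apply: (noP3 _ _ sub)|apply: (noP4 _ _ sub)].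
Qed.

End K4.

(** * Longest paths in graphs of minimum degree 5 *)

(* Adjacency facts say nothing on indices and only slow the arithmetic down. *)
Ltac idx_lia :=
  repeat match goal with h : is_true (edge _ _) |- _ => clear h end; lia.

Section LongestPath.
Variable G : sgraph.
Hypothesis aspG : ASP G.
Hypothesis degG : forall x : G, 5 <= degree x.

(** A path with m edges; only the values v 0, ..., v m matter. *)
Definition is_path m (v : nat -> G) :=
  (forall k, k < m -> v k -- v k.+1) /\ {in leq^~ m &, injective v}.

Definition between i j := iota i.+1 (j - i.+1).

Lemma mem_between i j x : (x \in between i j) = (i < x < j).
Proof. by rewrite /between mem_iota; lia. Qed.

Section OnePath.
Variables (m : nat) (v : nat -> G).
Hypothesis pv : is_path m v.

Let e i j := v i -- v j.

Lemma path_up i j : i < j <= m -> path e i (rcons (between i j) j).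
Proof.
case: pv => vE _; rewrite /between => /andP[ij jm].
rewrite -{2}(subnKC ij) -cats1.
have : i.+1 + (j - i.+1) <= m by rewrite subnKC.
move: (j - i.+1) => n {ij jm}.
elim: n i => [|n IH] i le_m /=; first by rewrite addn0 /e vE //; lia.
by rewrite /e vE ?addnS -?addSn ?IH //; lia.
Qed.

Lemma path_down i j : i < j <= m -> path e j (rcons (rev (between i j)) i).
Proof.
move/path_up => pij; have := rev_path e i (rcons (between i j) j).
rewrite last_rcons belast_rcons rev_cons => h.
by rewrite h; apply: sub_path pij => x y; rewrite /e edge_sym.
Qed.

(** The forbidden configuration, with vertices named by their indices along a
    path: disjointness becomes a statement on lists of numbers. *)
Lemma path_no_K4 a b c d p q r s :
    uniq (flatten [:: [:: a]; [:: b]; [:: c]; [:: d]; p; q; r; s]) ->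
    all (leq^~ m) (flatten [:: [:: a]; [:: b]; [:: c]; [:: d]; p; q; r; s]) ->
    p != [::] -> q != [::] -> r != [::] ->
    path e a (rcons p c) -> path e b (rcons q d) ->
    path e a (rcons r d) -> path e c (rcons s d) -> e a b -> e b c ->
  False.
Proof.
move=> U /allP le_m p0 q0 r0 Pp Pq Pr Ps ab bc.
have nn (l : seq nat) : l != [::] -> map v l != [::] by case: l.
have pm x l y : path e x (rcons l y) ->
    path (@edge G) (v x) (rcons (map v l) (v y)).
  by move=> h; rewrite -map_rcons path_map.
apply: (@ASP_no_K4 G (v a) (v b) (v c) (v d) (map v p) (map v q)
                     (map v r) (map v s)); rewrite ?nn //; do ?exact: pm.
set bl := flatten _ in U le_m.
suff -> : flatten [:: [:: v a]; [:: v b]; [:: v c]; [:: v d];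
   [seq v i | i <- p]; [seq v i | i <- q]; [seq v i | i <- r];
   [seq v i | i <- s]] = map v bl.
  by rewrite map_inj_in_uniq // => x y /le_m xm /le_m; apply: pv.2.
by rewrite /bl map_flatten.
Qed.

End OnePath.

(** Reversing the first i vertices (Posa rotation). *)
Definition rotate i (v : nat -> G) j := if j < i then v (i.-1 - j) else v j.

Lemma rotate_path m v i : is_path m v -> 0 < i <= m -> v 0 -- v i ->
  is_path m (rotate i v).
Proof.
move=> [vE vI] /andP[i0 im] vi; split=> [k km|x y xm ym].
  rewrite /rotate; have [ki|ki] := ltnP k i; have [ki'|ki'] := ltnP k.+1 i.
  - rewrite edge_sym; have -> : i.-1 - k = (i.-1 - k.+1).+1 by lia.
    by apply: vE; lia.
  - have -> : i.-1 - k = 0 by lia.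
    by have -> : k.+1 = i by lia.
  - lia.
  - exact: vE.
rewrite !unfold_in /= in xm ym; rewrite /rotate.
by case: ltnP => hx; case: ltnP => hy /vI; rewrite !unfold_in /=; lia.
Qed.

Definition nbr_count (v : nat -> G) n := count (fun j => v 0 -- v j) (iota 1 n).

Section Longest.
Variable m : nat.
Hypothesis maxm : forall v, is_path m v -> forall y, v 0 -- y ->
  exists2 j, 0 < j <= m & y = v j.

Lemma nbr_count_ge5 v : is_path m v -> 5 <= nbr_count v m.
Proof.
move=> pv; apply: leq_trans (degG (v 0)) _.
rewrite /degree cardE /nbr_count -size_filter -(size_map v).
apply: uniq_leq_size; first exact: enum_uniq.
move=> y; rewrite mem_enum inE => vy.
have [j jm yE] := maxm pv vy; rewrite yE; apply: map_f.
by rewrite mem_filter -yE vy mem_iota; lia.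
Qed.

(** Counting tool: either the neighbors of v 0 beyond index n all have their
    index in l, which bounds their number, or one of them escapes l. *)
Lemma nbr_count_split v n l : n <= m ->
  nbr_count v m <= nbr_count v n + count (fun j => v 0 -- v j) l \/
  exists2 z, n < z <= m & (v 0 -- v z) && (z \notin l).
Proof.
move=> nm; set f := fun j => v 0 -- v j.
case: (boolP (has (fun z => f z && (z \notin l)) (iota n.+1 (m - n)))) => [|no].
  by case/hasP => z; rewrite mem_iota => zn fz; right; exists z => //; lia.
left; rewrite /nbr_count -{1}(subnKC nm) iotaD count_cat leq_add2l add1n.
rewrite -!size_filter; apply: uniq_leq_size; first exact/filter_uniq/iota_uniq.
move=> z; rewrite !mem_filter => /andP[fz zn]; apply/andP; split=> //.
by move/hasPn/(_ z zn): no; rewrite negb_and negbK => /orP[/negP[]|].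
Qed.

Ltac in_lia :=
  rewrite /= ?(mem_cat, mem_rev, mem_between, mem_rcons, in_nil, inE) /=;
  idx_lia.

Ltac disjoint_paths :=
  rewrite /flatten /= ?cats0 ?rev_rcons;
  rewrite ?(cat_uniq, cons_uniq, rcons_uniq, rev_uniq, iota_uniq);
  repeat (apply/andP; split);
  first [ done | exact: iota_uniq | apply/hasPn => ?; solve [in_lia]
        | solve [in_lia] ].

Ltac bounded := apply/allP => ?; rewrite /flatten /=; in_lia.

Lemma between_neq0 i j : i.+1 < j -> between i j != [::].
Proof. by rewrite -size_eq0 size_iota -lt0n subn_gt0. Qed.

Lemma rev_between_neq0 i j : i.+1 < j -> rev (between i j) != [::].
Proof. by rewrite -size_eq0 size_rev size_eq0; apply: between_neq0. Qed.

Lemma rcons_neq0 (s : seq nat) x : rcons s x != [::].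
Proof. by case: s. Qed.

(** An index z between i + 1 and l yields the cycle v_0 ... v_l with the
    crossing chords v_0 v_i and v_(i-1) v_z, and three of the four gaps on the
    cycle have length at least 2.  An index z beyond l yields the path
    v_l v_0 v_i v_(i-1) of unsubdivided edges, whose ends are joined through
    v_z. *)
Lemma endpoint_nbrs v i l z : is_path m v -> 3 <= i -> i.+2 <= l <= m ->
  v 0 -- v i -> v 0 -- v l -> v i.-1 -- v z -> z <= m ->
  z <= i.+1 \/ z = l.
Proof.
move=> pv i3 /andP[il lm] v0i v0l viz zm.
have [zi|zi] := leqP z i.+1; [by left|right].
have [//|zl] := eqVneq z l; exfalso.
have vii : v i -- v i.-1.
  rewrite edge_sym; have {2}-> : i = i.-1.+1 by idx_lia.
  by apply: pv.1; idx_lia.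
have [zl'|lz] := ltnP z l.
  apply: (path_no_K4 pv (a := 0) (b := i) (c := i.-1) (d := z)
    (p := between 0 i.-1) (q := between i z) (r := l :: rev (between z l))
    (s := [::])) => //.
  - disjoint_paths.
  - bounded.
  - by apply: between_neq0; idx_lia.
  - by apply: between_neq0; idx_lia.
  - by apply: (path_up pv); idx_lia.
  - by apply: (path_up pv); idx_lia.
  - by rewrite /= v0l; apply: (path_down pv); idx_lia.
  - by rewrite /= viz.
apply: (path_no_K4 pv (a := l) (b := 0) (c := i) (d := i.-1)
  (p := rev (between i l)) (q := between 0 i.-1) (r := rcons (between l z) z)
  (s := [::])) => //.
- disjoint_paths.
- bounded.
- by apply: rev_between_neq0; idx_lia.
- by apply: between_neq0; idx_lia.
- exact: rcons_neq0.
- by apply: (path_down pv); idx_lia.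
- by apply: (path_up pv); idx_lia.
- by rewrite rcons_path last_rcons edge_sym viz (path_up pv) //; idx_lia.
- by rewrite /= vii.
- by rewrite edge_sym.
Qed.

(** Here p bounds from below, for all longest paths, the index of the third
    neighbor of the first vertex. *)
Section Extremal.
Variable p : nat.
Hypothesis minp : forall w, is_path m w -> nbr_count w p.-1 <= 2.
Hypothesis p3 : 3 <= p.

(** Minimality of p leaves at most two of the five neighbors below p, so if
    only three indices from p on are available, all three are taken. *)
Lemma high_nbrs w l : is_path m w -> p <= m ->
  (forall z, p <= z <= m -> w 0 -- w z -> z \in [:: p; p.+1; l]) ->
  [/\ w 0 -- w p, w 0 -- w p.+1, w 0 -- w l & 2 <= nbr_count w p.-1].
Proof.
move=> pw pm high.
have := nbr_count_ge5 pw; have := minp pw.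
have pm' : p.-1 <= m by idx_lia.
have [|[z zm /andP[wz]]] := nbr_count_split w [:: p; p.+1; l] pm'.
  rewrite /=; case: (w 0 -- w p); case: (w 0 -- w p.+1); case: (w 0 -- w l);
    rewrite /= => h1 h2 h3; split=> //; idx_lia.
by rewrite high //; idx_lia.
Qed.

(** The neighbors of w 0 = v (p - 1) follow from [endpoint_nbrs].  As for
    w 0 -- w 2: besides w 1, there is a neighbor w q with 2 <= q < p.  If
    q >= 3, rotating once more at q gives a first vertex whose neighbors from
    p on have index q + 1 or l, which makes at most 4 neighbors in all. *)
Lemma extremal_step v l : is_path m v -> v 0 -- v p -> p.+2 <= l <= m ->
  v 0 -- v l -> let w := rotate p v in
  [/\ is_path m w, w 0 -- w p, w 0 -- w p.+1, w 0 -- w l & w 0 -- w 2].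
Proof.
move=> pv v0p lm v0l w.
have pw : is_path m w by apply: rotate_path => //; idx_lia.
have wE z : p <= z -> w z = v z by rewrite /w /rotate ltnNge => ->.
have w0 : w 0 = v p.-1 by rewrite /w /rotate subn0 (ltn_trans _ p3).
have [||w0p w0p1 w0l cnt2] := high_nbrs (l := l) pw; first idx_lia.
  move=> z /andP[pz zm]; rewrite w0 (wE z) // => w0z.
  have := endpoint_nbrs pv p3 lm v0p v0l w0z zm; rewrite !inE; idx_lia.
split=> //.
have : has (fun j => w 0 -- w j) (iota 2 p.-2).
  rewrite has_count; move: cnt2; rewrite /nbr_count.
  have -> : p.-1 = p.-2.+1 by idx_lia.
  by rewrite /=; case: (_ -- _) => //=; idx_lia.
case/hasP => q; rewrite mem_iota => qp w0q.
have [<- //|q2] := eqVneq q 2; exfalso.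
have q3 : 3 <= q by idx_lia.
pose x := rotate q w.
have px : is_path m x by apply: rotate_path => //; idx_lia.
have xE z : q <= z -> x z = w z by rewrite /x /rotate ltnNge => ->.
have x0 : x 0 = w q.-1 by rewrite /x /rotate subn0 (ltn_trans _ q3).
have := nbr_count_ge5 px; have := minp px.
have pm' : p.-1 <= m by idx_lia.
have [|[z zm /andP[wz]]] := nbr_count_split x [:: q.+1; l] pm'.
  by rewrite /=; case: (_ -- _); case: (_ -- _) => /=; idx_lia.
have [] := @endpoint_nbrs w q l z pw q3 _ w0q w0l _ _; first idx_lia.
- by rewrite -x0 -xE //; idx_lia.
- by idx_lia.
- by rewrite !inE; idx_lia.
- by move=> ->; rewrite !inE eqxx orbT.
Qed.

Lemma rotateE i v : 0 < i -> (rotate i v 0 = v i.-1) *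
  (forall z, i <= z -> rotate i v z = v z).
Proof.
move=> i0; split; first by rewrite /rotate i0 subn0.
by move=> z iz; rewrite /rotate ltnNge iz.
Qed.

(** Rotating at p shows that v (p - 1) is adjacent to v p, v (p + 1) and v l,
    like v 0.  Each of the four exclusions below exhibits the forbidden
    configuration: l > p + 2; a neighbor of v 1 beyond p + 2; p >= 4; a
    neighbor of v 3 beyond 5. *)
Lemma extremal_K6 v l : is_path m v -> p.+2 <= l <= m -> v 0 -- v p ->
  v 0 -- v p.+1 -> v 0 -- v l -> v 0 -- v 2 -> subgraph (complete 6) G.
Proof.
move=> pv lm v0p v0p1 v0l v02.
have vS k : k < m -> v k -- v k.+1 := pv.1 k.
have p1 : p = p.-1.+1 by idx_lia.
have vpp : v p.-1 -- v p by rewrite {2}p1; apply: vS; idx_lia.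
have [_ + + + _] := extremal_step pv v0p lm v0l.
have p0 : 0 < p by idx_lia.
rewrite !rotateE //; try idx_lia.
move=> _ vpp1 vpl.
(* the cycle v_0 ... v_(p-1) v_l ... v_p with the chords v_0 v_l and
   v_(p-1) v_(p+1) *)
have lE : l = p.+2.
  have [] // := eqVneq l p.+2 => lne; exfalso.
  apply: (path_no_K4 pv (a := 0) (b := l) (c := p.-1) (d := p.+1)
    (p := between 0 p.-1) (q := rev (between p.+1 l)) (r := [:: p])
    (s := [::])) => //.
  - disjoint_paths.
  - bounded.
  - by apply: between_neq0; idx_lia.
  - by apply: rev_between_neq0; idx_lia.
  - by apply: (path_up pv); idx_lia.
  - by apply: (path_down pv); idx_lia.
  - by rewrite /= v0p vS //; idx_lia.
  - by rewrite /= vpp1.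
  - by rewrite edge_sym.
subst l.
have pp1 : v p -- v p.+1 by apply: vS; idx_lia.
have pp2 : v p.+1 -- v p.+2 by apply: vS; idx_lia.
have v01 : v 0 -- v 1 by apply: vS; idx_lia.
have v12 : v 1 -- v 2 by apply: vS; idx_lia.
have v1_high z : z <= m -> v 1 -- v z -> z <= p.+2.
  move=> zm v1z; rewrite leqNgt; apply/negP => lz.
  apply: (path_no_K4 pv (a := p.+2) (b := 0) (c := 1) (d := p.-1)
    (p := rcons (between p.+2 z) z) (q := [:: p]) (r := [:: p.+1])
    (s := between 1 p.-1)) => //.
  - disjoint_paths.
  - bounded.
  - exact: rcons_neq0.
  - rewrite rcons_path last_rcons edge_sym v1z (path_up pv) //; idx_lia.
  - by rewrite /= v0p edge_sym vpp.
  - by rewrite /= edge_sym pp2 edge_sym vpp1.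
  - by apply: (path_up pv); idx_lia.
  - by rewrite edge_sym.
pose w := rotate 2 v.
have pw : is_path m w by apply: rotate_path => //; idx_lia.
have [||w0p w0p1 w0l _] := high_nbrs (l := p.+2) pw; first idx_lia.
  move=> z /andP[pz zm]; rewrite /w !rotateE //=; last by idx_lia.
  by move=> /(v1_high _ zm); rewrite !inE; idx_lia.
move: w0p w0p1 w0l; rewrite /w !rotateE //; try idx_lia; rewrite /= => v1p v1p1 v1p2.
(* otherwise the cycle v_0 ... v_(p+2) has the crossing chords
   v_(p-1) v_(p+2) and v_p v_1 *)
have pE : p = 3.
  apply/eqP; rewrite eqn_leq p3 andbT leqNgt; apply/negP => p4.
  apply: (path_no_K4 pv (a := p.+2) (b := p.-1) (c := p) (d := 1)
    (p := [:: p.+1]) (q := rev (between 1 p.-1)) (r := [:: 0])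
    (s := [::])) => //.
  - disjoint_paths.
  - bounded.
  - by apply: rev_between_neq0; idx_lia.
  - by rewrite /= ![v p.+2 -- _]edge_sym pp2 edge_sym pp1.
  - by apply: (path_down pv); idx_lia.
  - by rewrite /= edge_sym v0l v01.
  - by rewrite /= edge_sym v1p.
  - by rewrite edge_sym.
move: pE p1 => -> _ in vpp vpp1 vpl lm v0p v0p1 v0l pp1 pp2 v1p v1p1 v1p2 *.
have v3_high z : z <= m -> v 3 -- v z -> z <= 5.
  move=> zm v3z; rewrite leqNgt; apply/negP => lz.
  apply: (path_no_K4 pv (a := 5) (b := 0) (c := 3) (d := 2)
    (p := rcons (between 5 z) z) (q := [:: 1]) (r := [:: 4])
    (s := [::])) => //.
  - disjoint_paths.
  - bounded.
  - exact: rcons_neq0.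
  - rewrite rcons_path last_rcons edge_sym v3z (path_up pv) //; idx_lia.
  - by rewrite /= v01 v12.
  - by rewrite /= edge_sym pp2 edge_sym vpp1.
  - by rewrite /= edge_sym vpp.
  - by rewrite edge_sym.
(* the only edge among v_0, ..., v_5 still missing: v_3 has five neighbors,
   all of index at most 5 *)
have v35 : v 3 -- v 5.
  have pw' : is_path m (rotate 4 v) by apply: rotate_path => //; idx_lia.
  have := nbr_count_ge5 pw'.
  have [|[z zm /andP[wz]]] :=
      nbr_count_split (rotate 4 v) [:: 1; 2; 3; 4; 5] (leq0n m).
    rewrite /= -[rotate 4 v 0]/(v 3) -[rotate 4 v 5]/(v 5) -[nbr_count _ 0]/0.
    case: (v 3 -- v 5) => //.
    by rewrite /=; do 4!case: (v 3 -- _); idx_lia.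
  have [z6|z6] := ltnP z 6; first by rewrite !inE; idx_lia.
  move: wz; rewrite !rotateE //=; last by idx_lia.
  by move/v3_high; idx_lia.
have vE i j : i < j < 6 -> v i -- v j.
  case: i j => [|[|[|[|[|[|i]]]]]] [|[|[|[|[|[|j]]]]]] //.
  by rewrite andbC.
exists (fun i : 'I_6 => v i) => [i j vij|i j].
  by apply: val_inj; apply: pv.2 vij; rewrite unfold_in /=;
    [have := ltn_ord i|have := ltn_ord j]; idx_lia.
move=> ij; have {ij}: i != j := ij; rewrite -(inj_eq val_inj) neq_ltn.
by case/orP => ij; [|rewrite edge_sym]; apply: vE; rewrite ij ltn_ord.
Qed.

End Extremal.

Hypothesis noK6 : ~ subgraph (complete 6) G.

(** Strong induction on p provides the minimality required above. *)
Lemma no_longest_path p v : p <= m -> is_path m v -> 3 <= nbr_count v p -> False.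
Proof.
elim/ltn_ind: p v => p IH v pm pv cp.
have p3 : 3 <= p.
  by apply: leq_trans cp _; rewrite -[leqRHS](size_iota 1) count_size.
have minp w : is_path m w -> nbr_count w p.-1 <= 2.
  move=> pw; rewrite leqNgt; apply/negP => cw.
  by apply: (IH p.-1 _ w) => //; idx_lia.
have v0p : v 0 -- v p.
  have := minp v pv; move: cp; rewrite /nbr_count.
  have {1}-> : p = p.-1 + 1 by idx_lia.
  rewrite iotaD count_cat /= add1n prednK; last by idx_lia.
  by case: (v 0 -- v p) => //=; idx_lia.
have pm' : p.-1 <= m by idx_lia.
have [h|[l lm /andP[v0l]]] := nbr_count_split v [:: p; p.+1] pm'.
  have := nbr_count_ge5 pv; have := minp v pv.
  by move: h => /=; case: (v 0 -- v p); case: (v 0 -- v p.+1); idx_lia.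
rewrite !inE => lp; have {lp}lm : p.+2 <= l <= m by idx_lia.
have [pw w0p w0p1 w0l w02] := extremal_step minp p3 pv v0p lm v0l.
exact: noK6 (extremal_K6 minp p3 pw lm w0p w0p1 w0l w02).
Qed.
End Longest.

(** Induction on #|G| - m: a path that some neighbor of its first vertex
    extends leads to a longer one, so m may be taken maximal. *)
Lemma mindeg5_K6 (x : G) : ~ ~ subgraph (complete 6) G.
Proof.
move=> noK6.
suff noP n m v : #|G| <= m + n -> is_path m v -> False.
  apply: (noP #|G| 0 (fun=> x)) => //; split=> // i j.
  by rewrite !unfold_in !leqn0 => /eqP-> /eqP->.
elim: n m v => [|n IH] m v le_G pv.
  have : uniq (map v (iota 0 m.+1)).
    rewrite map_inj_in_uniq ?iota_uniq // => i j; rewrite !mem_iota => im jm.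
    by apply: pv.2; rewrite unfold_in /=; idx_lia.
  move/card_uniqP; rewrite size_map size_iota => h.
  by have := max_card (mem (map v (iota 0 m.+1))); rewrite h; idx_lia.
have maxm w : is_path m w -> forall y, w 0 -- y ->
    exists2 j, 0 < j <= m & y = w j.
  move=> [wE wI] y wy.
  have [/mapP[j jm yE]|yw] := boolP (y \in map w (iota 0 m.+1)).
    exists j => //; move: jm; rewrite mem_iota.
    case: j yE => [yE|j _]; last by idx_lia.
    by rewrite yE edge_irrefl in wy.
  have yN k : k <= m -> y != w k.
    move=> km; apply: contraNneq yw => ->; apply: map_f.
    by rewrite mem_iota; idx_lia.
  exfalso; apply: (IH m.+1 (fun k => if k is k'.+1 then w k' else y)).
    by rewrite addSnnS.
  split=> [[|k] km|[|i] [|j]]; rewrite ?unfold_in //=.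
  - by rewrite edge_sym.
  - exact: wE.
  - by move=> _ jm yE; have := yN j jm; rewrite yE eqxx.
  - by move=> jm _ yE; have := yN i jm; rewrite yE eqxx.
  - by move=> im jm /wI ->.
have cm := nbr_count_ge5 maxm pv.
exact: (no_longest_path maxm noK6 (leqnn m) pv (ltnW (ltnW cm))).
Qed.
End LongestPath.

(** * Degeneracy *)

Section Induced.
Variables (G : sgraph) (S : {set G}).

Definition induced_rel : rel {x : G | x \in S} := fun a b => val a -- val b.
Lemma induced_sym : symmetric induced_rel.
Proof. by move=> a b; apply: edge_sym. Qed.
Lemma induced_irrefl : irreflexive induced_rel.
Proof. by move=> a; apply: edge_irrefl. Qed.
Definition induced : sgraph := SGraph induced_sym induced_irrefl.

Lemma induced_subgraph : subgraph induced G.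
Proof. by exists val; first exact: val_inj. Qed.

Lemma degree_induced (x : induced) :
  degree x = #|[set y in S | val x -- y]|.
Proof.
rewrite /degree -(card_imset _ val_inj); apply: eq_card => y.
rewrite inE; apply/imsetP/andP => [[z]|[yS xy]].
  by rewrite inE => xz ->; split=> //; apply: valP.
by exists (exist _ y yS); rewrite ?inE.
Qed.

End Induced.

(** Otherwise S induces a graph of minimum degree at least 5. *)
Lemma ASP_degenerate (G : sgraph) (S : {set G}) :
    ASP G -> ~ subgraph (complete 6) G -> S != set0 ->
  exists2 x, x \in S & #|[set y in S | x -- y]| <= 4.
Proof.
move=> [aspG3 aspG4] noK6 /set0Pn[x xS].
apply/exists_inP; apply/contraT => /exists_inPn noS; exfalso.
have sub H : subgraph H (induced S) -> subgraph H G.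
  by move=> h; apply: subgraph_trans h (induced_subgraph S).
apply: (@mindeg5_K6 (induced S) _ _ (exist _ x xS)).
- by split=> H HP /sub; [apply: aspG3|apply: aspG4].
- move=> y; rewrite degree_induced ltnNge; apply: noS; exact: valP.
- by move/sub.
Qed.

(** * Peeling orders and greedy colorings *)

(** Vertices are the numbers below N, adjacent according to A, and carry
    labels: 0 for a vertex not yet removed, 6 + j for the vertex removed in
    round j, and c in 1..5 for a vertex of color c.  The labels of removed
    vertices thus exceed those of colors. *)
Section Labels.
Variables (N : nat) (A : nat -> nat -> bool).
Hypothesis Asym : forall u v, u < N -> v < N -> A u v = A v u.
Hypothesis Airr : forall u, u < N -> A u u = false.
Implicit Types a : nat -> nat.

Definition nbr_with (P : pred nat) u := count (fun v => A u v && P v) (iota 0 N).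

Lemma nbr_with_le (P Q : pred nat) u : (forall v, v < N -> A u v -> P v -> Q v) ->
  nbr_with P u <= nbr_with Q u.
Proof.
move=> PQ; rewrite /nbr_with -!size_filter.
apply: uniq_leq_size; first exact/filter_uniq/iota_uniq.
move=> v; rewrite !mem_filter mem_iota add0n => /andP[/andP[uv Pv] vN].
by rewrite uv PQ // vN.
Qed.

(** State after j rounds of removal.  The second clause counts the neighbors
    that were still present when v was removed. *)
Definition peeled j a :=
  [/\ forall v, v < N -> a v = 0 \/ 6 <= a v < 6 + j,
      forall v, v < N -> a v != 0 ->
        nbr_with (fun w => (a w == 0) || (a v <= a w)) v <= 4
    & count (fun v => a v == 0) (iota 0 N) = N - j].

Lemma eq_nbr_with P Q u : (forall v, v < N -> P v = Q v) ->
  nbr_with P u = nbr_with Q u.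
Proof.
by move=> PQ; apply: eq_in_count => v; rewrite mem_iota => /andP[_ /PQ->].
Qed.

Lemma peeled_ext j a b : (forall v, v < N -> a v = b v) ->
  peeled j a -> peeled j b.
Proof.
move=> ab [p1 p2 p3]; split=> [v vN|v vN|]; rewrite -?ab //; first exact: p1.
  move=> av; rewrite -(@eq_nbr_with (fun w => (a w == 0) || (a v <= a w))) ?p2 //.
  by move=> w wN; rewrite ab.
by rewrite -p3; apply: eq_in_count => v; rewrite mem_iota => /andP[_ /ab->].
Qed.

Lemma peeled_step j a u : peeled j a -> u < N -> a u = 0 ->
  nbr_with (fun w => a w == 0) u <= 4 -> peeled j.+1 (upd a u (6 + j)).
Proof.
move=> [aval adeg acount] uN au ud; rewrite /upd; split=> [v vN|v vN|].
- by case: eqP => _; [right|have := aval v vN]; lia.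
- have [->|vu] := eqVneq v u.
    move=> _; apply: leq_trans ud; apply: nbr_with_le => w wN uw.
    case: (w =P u) => [wu|_]; first by rewrite wu Airr in uw.
    by have := aval w wN; lia.
  move=> av; apply: leq_trans (adeg v vN av); apply: nbr_with_le => w wN _.
  by case: (w =P u) => [->|//]; rewrite au.
- have uI : u \in iota 0 N by rewrite mem_iota.
  have/permP/(_ (fun v => a v == 0)) := perm_to_rem uI.
  have/permP/(_ (fun v => (if v == u then 6 + j else a v) == 0)) := perm_to_rem uI.
  move=> -> /=; rewrite acount au !eqxx /= add0n => h.
  have -> : N - j.+1 = (N - j).-1 by lia.
  rewrite h /=; apply: eq_in_count => v.
  by rewrite (mem_rem_uniq _ (iota_uniq 0 N)) !inE => /andP[/negPf-> _].
Qed.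

Variable a0 : nat -> nat.

(** Coloring undoes the removals: the labels a0 left by the removal are
    treated from the largest to the least, and for each of them all vertices
    are scanned.  In this state the labels above m are done, and so is m for
    the vertices below i. *)
Definition colored m i a :=
  [/\ forall v, v < N -> a v = a0 v \/ (1 <= a v <= 5) && (m <= a0 v),
      forall v, v < N -> (m < a0 v) || (v < i) && (m == a0 v) -> a v <= 5
    & forall v w, v < N -> w < N -> A v w -> a v <= 5 -> a w <= 5 -> a v != a w].

Lemma colored_ext m i a b : (forall v, v < N -> a v = b v) ->
  colored m i a -> colored m i b.
Proof.
move=> ab [c1 c2 c3]; split=> [v vN|v vN|v w vN wN]; rewrite -!ab //.
- exact: c1.
- exact: c2.
- exact: c3.
Qed.

Lemma colored_next m a : colored m.+1 N a -> colored m 0 a.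
Proof.
move=> [c1 c2 c3]; split=> // v vN; first by have := c1 v vN; lia.
by move=> h; apply: c2 => //; lia.
Qed.

Hypothesis peel0 : peeled N a0.

Let a0_ge6 v : v < N -> 6 <= a0 v < 6 + N.
Proof.
case: peel0 => aval _; rewrite subnn => /eqP.
rewrite -leqn0 leqNgt -has_count => /hasPn a0N0 vN.
by have := a0N0 v; rewrite mem_iota => /(_ vN) /eqP; have := aval v vN; lia.
Qed.

Lemma colored_start : colored (5 + N) 0 a0.
Proof.
split=> [v vN|v vN|v w vN]; [by left| |]; have := a0_ge6 vN; lia.
Qed.

Lemma colored_skip m i a : i < N -> colored m i a -> a i != m -> colored m i.+1 a.
Proof.
move=> iN [c1 c2 c3] aim; split=> // v vN mv.
have [vi|vi] := eqVneq v i; last by apply: c2 => //; lia.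
have [/eqP a0m|a0m] := boolP (m == a0 v).
  by have := c1 v vN; rewrite -a0m vi; lia.
by apply: c2 => //; lia.
Qed.

Lemma colored_step m i c a : i < N -> colored m i a -> a i = m -> 6 <= m ->
  1 <= c <= 5 -> nbr_with (fun w => a w == c) i = 0 -> colored m i.+1 (upd a i c).
Proof.
move=> iN [c1 c2 c3] ai m6 c5 /eqP; rewrite -leqn0 leqNgt -has_count => /hasPn free.
have {}free w : w < N -> A i w -> a w != c.
  by move=> wN iw; have := free w; rewrite mem_iota iw => /(_ wN).
have a0i : a0 i = m by have := c1 i iN; lia.
rewrite /upd; split=> [v vN|v vN mv|v w vN wN vw].
- by case: eqP => [->|_]; [rewrite a0i leqnn c5; right|exact: c1].
- by case: eqP => [_|/eqP vi]; [lia|apply: c2; lia].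
- case: (v =P i) => [vi|_]; case: (w =P i) => [wi|_].
  + by rewrite vi wi Airr in vw.
  + by move=> _ _; rewrite eq_sym free // -vi.
  + by move=> _ _; rewrite free // Asym // -wi.
  + exact: c3.
Qed.

(** The colored neighbors of i were still present when i was removed, so they
    are at most four and miss one of the five colors. *)
Lemma colored_free m i a : i < N -> colored m i a -> a i = m -> 6 <= m ->
  exists2 c, 1 <= c <= 5 & nbr_with (fun w => a w == c) i = 0.
Proof.
move=> iN [c1 c2 c3] ai m6.
have a0i : a0 i = m by have := c1 i iN; lia.
have [_ /(_ i iN) deg _] := peel0.
have {}deg : nbr_with (fun w => 1 <= a w <= 5) i <= 4.
  apply: leq_trans (deg _); last by lia.
  by apply: nbr_with_le => w wN _; have := c1 w wN; have := a0_ge6 wN; lia.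
pose n c := nbr_with (fun w => a w == c) i.
have sum_n : n 1 + n 2 + n 3 + n 4 + n 5 <= 4.
  apply: leq_trans deg; rewrite /n /nbr_with.
  elim: (iota 0 N) => //= v s; case: (A i v) => //=.
  by case: (a v) => [|[|[|[|[|[|?]]]]]] /=; lia.
have [|n1] := posnP (n 1); first by exists 1.
have [|n2] := posnP (n 2); first by exists 2.
have [|n3] := posnP (n 3); first by exists 3.
have [|n4] := posnP (n 4); first by exists 4.
have [|n5] := posnP (n 5); first by exists 5.
lia.
Qed.

Lemma colored_end a : colored 5 0 a ->
  (forall v, v < N -> 1 <= a v <= 5) /\
  (forall v w, v < N -> w < N -> A v w -> a v != a w).
Proof.
move=> [c1 c2 c3].
have a5 v : v < N -> a v <= 5.
  by move=> vN; apply: c2 => //; have := a0_ge6 vN; lia.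
split=> [v vN|v w vN wN vw]; last by apply: c3; rewrite ?a5.
by have := a5 v vN; have := c1 v vN; have := a0_ge6 vN; lia.
Qed.

End Labels.

(** * Structured programs *)

(** [Line s] stands for straight-line code, [IfZ r c] executes c when register
    r is 0, so that one forward jump suffices, and [Rep r c] repeats c until r
    is 0, with the test at the end: the body is executed at least once. *)
Inductive com :=
| Line of seq instr
| Seq of com & com
| IfZ of nat & com
| Rep of nat & com.

Local Notation "c1 ;; c2" := (Seq c1 c2) (at level 60, right associativity).

Fixpoint code_size c :=
  match c with
  | Line s => size s
  | Seq c1 c2 => code_size c1 + code_size c2
  | IfZ _ c1 => (code_size c1).+1
  | Rep _ c1 => (code_size c1).+1
  end.

Fixpoint compile l c : program :=
  match c with
  | Line s => s
  | Seq c1 c2 => compile l c1 ++ compile (l + code_size c1) c2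
  | IfZ r c1 => IJump (l + (code_size c1).+1) r :: compile l.+1 c1
  | Rep r c1 => rcons (compile l c1) (IJump l r)
  end.

Lemma size_compile l c : size (compile l c) = code_size c.
Proof.
elim: c l => //= [c1 IH1 c2 IH2|r c1 IH|r c1 IH] l.
- by rewrite size_cat IH1 IH2.
- by rewrite IH.
- by rewrite size_rcons IH.
Qed.

Record state := State { regs : nat -> nat; tape_in : seq nat; tape_out : seq nat }.

Definition at_line l s := Config l (regs s) (tape_in s) (tape_out s).

Definition is_jump i := if i is IJump _ _ then true else false.

Definition exec_state s i :=
  let: Config _ X x y := exec i (at_line 0 s) in State X x y.

Definition exec_line s is_ := foldl exec_state s is_.

Definition code_at (p : program) l (s : seq instr) :=
  forall i, i < size s -> onth p (l + i) = Some (nth (IPrint 0) s i).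

Lemma code_at_cat p l s1 s2 : code_at p l (s1 ++ s2) ->
  code_at p l s1 /\ code_at p (l + size s1) s2.
Proof.
move=> h; split=> i il.
  by rewrite h ?size_cat ?nth_cat ?il // ltn_addr.
by rewrite -addnA h ?size_cat ?ltn_add2l // nth_cat ltnNge leq_addr addKn.
Qed.

Lemma code_at_cons p l i s : code_at p l (i :: s) ->
  onth p l = Some i /\ code_at p l.+1 s.
Proof.
rewrite -cat1s => /code_at_cat[/(_ 0 isT)]; rewrite addn0 /= => -> .
by rewrite addn1.
Qed.

(** From state s, the code of c placed anywhere in a program leads in at most t
    steps to its last line, in state s'. *)
Definition runs c s t s' := forall p l, code_at p l (compile l c) ->
  exists2 k, k <= t & iter k (step p) (at_line l s) = at_line (l + code_size c) s'.

Lemma runs_le c s t t' s' : t <= t' -> runs c s t s' -> runs c s t' s'.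
Proof.
by move=> tt' r p l /r[k kt e]; exists k => //; apply: leq_trans kt tt'.
Qed.

Lemma runs_line is_ s : ~~ has is_jump is_ ->
  runs (Line is_) s (size is_) (exec_line s is_).
Proof.
move=> + p; elim: is_ s => [|i is_ IH] s /=.
  by exists 0; rewrite // addn0.
rewrite negb_or => /andP[ni nis] l /code_at_cons[pi /(IH (exec_state s i) nis)].
case=> k kt e; exists k.+1 => //; rewrite iterSr addnS -addSn -e; congr iter.
by rewrite /step /= pi; case: (i) ni.
Qed.

Lemma runs_seq c1 c2 s t1 s1 t2 s2 :
  runs c1 s t1 s1 -> runs c2 s1 t2 s2 -> runs (c1 ;; c2) s (t1 + t2) s2.
Proof.
move=> r1 r2 p l /= /code_at_cat[/r1[k1 le1 e1]]; rewrite size_compile.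
move=> /r2[k2 le2 e2]; exists (k2 + k1); first by rewrite addnC leq_add.
by rewrite iterD e1 e2 addnA.
Qed.

Lemma runs_skip r c s : 0 < regs s r -> runs (IfZ r c) s 1 s.
Proof.
by move=> sr p l /= /code_at_cons[pl _]; exists 1; rewrite //= /step /= pl /= sr.
Qed.

Lemma runs_then r c s t s' : regs s r = 0 -> runs c s t s' ->
  runs (IfZ r c) s t.+1 s'.
Proof.
move=> sr rc p l /= /code_at_cons[pl /rc[k kt e]]; exists k.+1 => //.
by rewrite iterSr /= /step /= pl /= sr /= e addnS addSn.
Qed.

(** A loop whose counter r decreases by 1 at each turn; I is indexed by the
    number of turns that remain. *)
Lemma runs_repeat (I : nat -> state -> Prop) r c t :
    (forall k s, I k.+1 s ->
       exists s', [/\ runs c s t s', I k s' & regs s' r = k]) ->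
  forall n s, 0 < n -> I n s ->
    exists2 s', runs (Rep r c) s (n * t.+1) s' & I 0 s'.
Proof.
move=> Hc [//|k] s _; elim: k s => [|k IH] s /Hc[s1 [r1 I1 s1r]].
  exists s1; rewrite // mul1n => p l /=; rewrite -cats1 => /code_at_cat[/r1[j jt e]].
  rewrite size_compile => /code_at_cons[pl _]; exists j.+1; rewrite //= e.
  by rewrite /step /= pl /= s1r addnS.
have [s2 r2 I2] := IH _ I1; exists s2 => // p l pl.
have [j2 jt2 e2] := r2 _ _ pl.
move: pl => /=; rewrite -cats1 => /code_at_cat[/r1[j1 jt1 e1]].
rewrite size_compile => /code_at_cons[pl _]; exists (j2 + j1.+1).
  by rewrite [leqRHS]mulSn addnC leq_add.
by rewrite iterD /= e1 /step /= pl /= s1r e2.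
Qed.

Lemma runs_computes c x t s :
  runs c (State (fun=> 0) x [::]) t s -> computes_within (compile 0 c) x t (tape_out s).
Proof.
move=> rc; have [|k kt e] := rc (compile 0 c) 0.
  by move=> i ic; rewrite add0n onthE (nth_map (IPrint 0)).
have hs : halted (compile 0 c) (at_line (code_size c) s).
  by rewrite /halted size_compile.
have stay j : iter j (step (compile 0 c)) (at_line (code_size c) s)
              = at_line (code_size c) s.
  by elim: j => //= j ->; rewrite /step onth_default.
by rewrite /computes_within -(subnK kt) iterD [iter k _ _]e stay.
Qed.

(** * The coloring program *)

(* The registers from r_test on are scratch registers.  The order makes the
   registers changed by count_nbrs, select and color_vertex intervals. *)
Local Notation r_one := 0 (only parsing).
Local Notation r_n := 1 (only parsing).
Local Notation r_labels := 2 (only parsing).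
Local Notation r_matrix := 3 (only parsing).
Local Notation r_zero := 4 (only parsing).
Local Notation r_four := 5 (only parsing).
Local Notation r_round := 6 (only parsing).
Local Notation r_mark := 7 (only parsing).
Local Notation r_label := 8 (only parsing).
Local Notation r_test := 9 (only parsing).
Local Notation r_x := 10 (only parsing).
Local Notation r_y := 11 (only parsing).
Local Notation r_p := 12 (only parsing).
Local Notation r_q := 13 (only parsing).
Local Notation r_j := 14 (only parsing).
Local Notation r_count := 15 (only parsing).
Local Notation r_sel := 16 (only parsing).
Local Notation r_row := 17 (only parsing).
Local Notation r_addr := 18 (only parsing).
Local Notation r_i := 19 (only parsing).

(** First address of the labels; the matrix follows, row by row. *)
Definition base := 20.

(** Truncated subtraction makes r_test zero exactly when the matrix entry is 1
    and the label read equals r_label. *)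
Definition count_nbr :=
  Line [:: ILoad r_x r_p; ILoad r_y r_q;
           ISub r_test r_one r_x;
           ISub r_x r_y r_label; IAdd r_test r_test r_x;
           ISub r_x r_label r_y; IAdd r_test r_test r_x;
           IAdd r_p r_p r_one; IAdd r_q r_q r_one; ISub r_j r_j r_one] ;;
  IfZ r_test (Line [:: IAdd r_count r_count r_one]).

Definition count_nbrs :=
  Line [:: IAdd r_p r_row r_zero; IAdd r_q r_labels r_zero; IConst r_count 0;
           IAdd r_j r_n r_zero] ;;
  Rep r_j count_nbr.

Definition first_vertex :=
  [:: IAdd r_addr r_labels r_zero; IAdd r_row r_matrix r_zero;
      IAdd r_i r_n r_zero].

Definition next_vertex :=
  [:: IAdd r_addr r_addr r_one; IAdd r_row r_row r_n; ISub r_i r_i r_one].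

(** The address in r_sel is that of a vertex of label 0 with at most four
    neighbors of label 0. *)
Definition select :=
  Line first_vertex ;;
  Rep r_i (
    count_nbrs ;;
    Line [:: ISub r_x r_count r_four; ILoad r_y r_addr; IAdd r_test r_x r_y] ;;
    IfZ r_test (Line [:: IAdd r_sel r_addr r_zero]) ;;
    Line next_vertex).

Definition peel :=
  Line [:: IConst r_label 0; IConst r_mark 6; IConst r_four 4;
           IAdd r_round r_n r_zero] ;;
  Rep r_round (
    select ;;
    Line [:: IStore r_sel r_mark; IAdd r_mark r_mark r_one;
             ISub r_round r_round r_one]).

(** The colors are tried from 5 down to 1, and the last one that no neighbor
    has is kept. *)
Definition color_vertex :=
  Line [:: IConst r_label 5] ;;
  Rep r_label (
    count_nbrs ;;
    IfZ r_count (Line [:: IAdd r_sel r_label r_zero]) ;;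
    Line [:: ISub r_label r_label r_one]) ;;
  Line [:: IStore r_addr r_sel].

Definition color :=
  Line [:: IAdd r_round r_n r_zero] ;;
  Rep r_round (
    Line (ISub r_mark r_mark r_one :: first_vertex) ;;
    Rep r_i (
      Line [:: ILoad r_x r_addr; ISub r_test r_x r_mark;
               ISub r_y r_mark r_x; IAdd r_test r_test r_y] ;;
      IfZ r_test color_vertex ;;
      Line next_vertex) ;;
    Line [:: ISub r_round r_round r_one]).

Definition read_matrix :=
  Line [:: IAdd r_p r_matrix r_zero; IAdd r_i r_n r_zero] ;;
  Rep r_i (
    Line [:: IAdd r_j r_n r_zero] ;;
    Rep r_j (
      Line [:: IRead r_x; IStore r_p r_x; IAdd r_p r_p r_one;
               ISub r_j r_j r_one]) ;;
    Line [:: ISub r_i r_i r_one]).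

Definition print_colors :=
  Line [:: IAdd r_addr r_labels r_zero; IAdd r_i r_n r_zero] ;;
  Rep r_i (
    Line [:: ILoad r_x r_addr; ISub r_x r_x r_one; IPrint r_x;
             IAdd r_addr r_addr r_one; ISub r_i r_i r_one]).

(* r_test is 1 on the empty graph, for which the loops, executed at least
   once, would be wrong *)
Definition coloring_program :=
  Line [:: IRead r_n; IConst r_one 1; ISub r_test r_one r_n] ;;
  IfZ r_test (
    Line [:: IConst r_labels base; IAdd r_matrix r_labels r_n] ;;
    read_matrix ;; peel ;; color ;; print_colors).

Ltac outside :=
  match goal with h : is_true (_ || _) |- is_true (_ != _) =>
    move: h; clear; lia end.

Section Correctness.
Variables (N : nat) (A : nat -> nat -> bool).

Definition constants (X : nat -> nat) :=
  [/\ X r_one = 1, X r_zero = 0, X r_n = N, X r_labels = base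
    & X r_matrix = base + N].

Definition ready (X : nat -> nat) :=
  constants X /\
  (forall u v, u < N -> v < N -> X (base + N + u * N + v) = A u v).

Definition labels (X : nat -> nat) v := X (base + v).

Definition frame lo hi (X X' : nat -> nat) :=
  forall i, (i < lo) || (hi < i) -> X' i = X i.

Lemma frame_ready lo hi X X' : r_four <= lo -> hi < base -> frame lo hi X X' ->
  ready X -> ready X'.
Proof.
move=> lo5 hiB F [[h1 h2 h3 h4 h5] h6]; rewrite /base in hiB; split.
  by split; rewrite F //; apply/orP; left; apply: leq_trans lo5.
by move=> u v uN vN; rewrite F ?h6 // /base; lia.
Qed.

Lemma frame_trans lo hi lo1 hi1 lo2 hi2 X Y Z :
  frame lo1 hi1 X Y -> frame lo2 hi2 Y Z ->
  lo <= lo1 -> lo <= lo2 -> hi1 <= hi -> hi2 <= hi -> frame lo hi X Z.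
Proof.
move=> F1 F2 *; move=> i hi'; rewrite F2 ?F1 //; lia.
Qed.

Lemma frame_labels lo hi X Y v : hi < base -> frame lo hi X Y ->
  labels Y v = labels X v.
Proof.
by move=> hiB F; rewrite /labels F // (leq_trans hiB) ?leq_addr ?orbT.
Qed.

Lemma upd_neq X i v j : j != i -> upd X i v j = X j.
Proof. by rewrite /upd => /negPf->. Qed.

Lemma base_neq n i : i < base -> (base + n == i) = false.
Proof. by move=> iB; apply/negbTE; rewrite neq_ltn (leq_trans iB) ?leq_addr ?orbT. Qed.

Lemma base_neqr n i : i < base -> (i == base + n) = false.
Proof. by rewrite eq_sym; apply: base_neq. Qed.

Hypothesis N0 : 0 < N.
Hypothesis Asym : forall u v, u < N -> v < N -> A u v = A v u.
Hypothesis Airr : forall u, u < N -> A u u = false.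
Hypothesis Adeg : forall P : pred nat, has P (iota 0 N) ->
  exists2 u, u < N & P u && (nbr_with N A P u <= 4).

(* In each proof below, I k (or J j) is the invariant of a loop with k turns
   left, so that the vertex being treated is v = N - k.+1. *)
Lemma count_nbrs_spec (s : state) u : ready (regs s) -> u < N ->
    regs s r_row = base + N + u * N ->
  exists s', [/\ runs count_nbrs s (4 + N * 13) s',
    frame r_test r_count (regs s) (regs s'),
    regs s' r_count = nbr_with N A (fun v => labels (regs s) v == regs s r_label) u
    & tape_in s' = tape_in s /\ tape_out s' = tape_out s].
Proof.
move=> [[h1 h2 h3 h4 h5] h6] uN hrow.
pose I k s' := [/\ k <= N,
   frame r_test r_count (regs s) (regs s'),
   [/\ regs s' r_p = base + N + u * N + (N - k),
       regs s' r_q = base + (N - k), regs s' r_j = k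
     & regs s' r_count
       = count (fun v => A u v && (labels (regs s) v == regs s r_label))
               (iota 0 (N - k))]
  & tape_in s' = tape_in s /\ tape_out s' = tape_out s].
set s1 := exec_line s [:: IAdd r_p r_row r_zero; IAdd r_q r_labels r_zero;
                          IConst r_count 0; IAdd r_j r_n r_zero].
have I1 : I N s1.
  rewrite /I subnn; split=> // [i hi|]; rewrite /s1 /=.
    by rewrite !upd_neq //; outside.
  by split; rewrite /upd /= ?hrow ?h2 ?h3 ?h4 ?addn0.
suff step k s2 : I k.+1 s2 ->
    exists s3, [/\ runs count_nbr s2 12 s3, I k s3 & regs s3 r_j = k].
  have [s2 r2 [_ F2 [_ _ _ c2] io2]] := runs_repeat step N0 I1.
  exists s2; split=> //; last by rewrite c2 subn0.
  by apply: runs_seq r2; exact: runs_line.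
case=> [kN F2 [p2 q2 j2 c2] io2].
pose v := N - k.+1; have vN : v < N by rewrite /v; lia.
have kE : N - k = v.+1 by rewrite /v; lia.
rewrite -/v in p2 q2 c2.
rewrite /count_nbr; set l := [:: _, _ & _]; pose s3 := exec_line s2 l.
have r3 : runs (Line l) s2 10 s3 by apply: runs_line.
have x3 : regs s2 (regs s2 r_p) = A u v.
  by rewrite p2 -!addnA F2 ?addnA ?h6 //; rewrite /base; lia.
have y3 : regs s2 (regs s2 r_q) = labels (regs s) v.
  by rewrite q2 F2 // /base; lia.
have l3 : regs s2 r_label = regs s r_label by rewrite F2.
have o3 : regs s2 r_one = 1 by rewrite F2.
have F3 : frame r_test r_count (regs s) (regs s3).
  by move=> i hi; rewrite /s3 /= !upd_neq ?F2 //; outside.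
have t3 : (regs s3 r_test == 0) = A u v && (labels (regs s) v == regs s r_label).
  rewrite /s3 /= /upd /= x3 q2 base_neq // -q2 y3 l3 o3.
  by case: (A u v); lia.
have c3 : regs s3 r_count = regs s2 r_count by [].
have pqj3 : [/\ regs s3 r_p = base + N + u * N + v.+1,
                regs s3 r_q = base + v.+1 & regs s3 r_j = k].
  by rewrite /s3 /= /upd /= p2 q2 j2 o3 !addn1 !addnS subn1.
have cE : count (fun v => A u v && (labels (regs s) v == regs s r_label)) (iota 0 v.+1)
          = regs s2 r_count + (regs s3 r_test == 0).
  by rewrite -[v.+1]addn1 iotaD count_cat -c2 /= addn0 t3.
have io3 : tape_in s3 = tape_in s /\ tape_out s3 = tape_out s by [].
clearbody s3; case: (pqj3) => p3 q3 j3.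
have [t0|t0] := eqVneq (regs s3 r_test) 0; last first.
  exists s3; split=> //.
    apply: (runs_le (t := 10 + 1)) => //; apply: runs_seq r3 _.
    by apply: runs_skip; lia.
  split=> //; first by lia.
  by split; rewrite ?kE // c3 cE (negPf t0) addn0.
exists (exec_line s3 [:: IAdd r_count r_count r_one]); split=> //.
  by apply: (runs_seq (t2 := 2) r3); apply: runs_then t0 _; apply: runs_line.
split=> //; first by lia.
  by move=> i hi; rewrite /= upd_neq ?F3 //; outside.
rewrite kE cE t0; split=> //.
by rewrite /= /upd /= c3 F3 // h1.
Qed.

Definition peelable (a : nat -> nat) u :=
  (a u == 0) && (nbr_with N A (fun v => a v == 0) u <= 4).

Lemma select_spec (s : state) : ready (regs s) ->
    regs s r_label = 0 -> regs s r_four = 4 ->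
    (exists2 u, u < N & peelable (labels (regs s)) u) ->
  exists s', [/\ runs select s (3 + N * (13 * N + 13)) s',
    frame r_test r_i (regs s) (regs s'),
    exists2 u, u < N & peelable (labels (regs s)) u /\ regs s' r_sel = base + u
    & tape_in s' = tape_in s /\ tape_out s' = tape_out s].
Proof.
move=> R lab0 four [u0 u0N u0P].
pose I k s' := [/\ k <= N, frame r_test r_i (regs s) (regs s'),
  [/\ regs s' r_row = base + N + (N - k) * N, regs s' r_addr = base + (N - k)
    & regs s' r_i = k],
  (exists2 u, u < N - k & peelable (labels (regs s)) u) ->
  exists2 u, u < N & peelable (labels (regs s)) u /\ regs s' r_sel = base + u
  & tape_in s' = tape_in s /\ tape_out s' = tape_out s].
have [[h1 h2 h3 h4 h5] h6] := R.
set s1 := exec_line s first_vertex.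
have I1 : I N s1.
  rewrite /I subnn; split=> // [i hi||[]//]; rewrite /s1 /=.
    by rewrite !upd_neq //; outside.
  by split; rewrite /upd /= ?h2 ?h3 ?h4 ?h5 ?addn0.
rewrite /select; set body := (X in Rep r_i X).
suff step k s2 : I k.+1 s2 ->
    exists s3, [/\ runs body s2 (13 * N + 12) s3, I k s3 & regs s3 r_i = k].
  have [s2 r2 [_ F2 _ sel2 io2]] := runs_repeat step N0 I1.
  exists s2; split=> //; last by apply: sel2; exists u0; rewrite ?subn0.
  by rewrite -addnS in r2; apply: runs_seq r2; exact: runs_line.
case=> kN F2 [row2 addr2 i2] sel2 io2.
pose v := N - k.+1; have vN : v < N by rewrite /v; lia.
have kE : N - k = v.+1 by rewrite /v; lia.
rewrite -/v in row2 addr2 sel2.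
have R2 := frame_ready (isT : r_four <= r_test) (isT : r_i < base) F2 R.
have [s3 [r3 F3 c3 io3]] := count_nbrs_spec R2 vN row2.
have F3' : frame r_test r_i (regs s) (regs s3) by refine (frame_trans F2 F3 _ _ _ _).
have row3 : regs s3 r_row = base + N + v * N by rewrite F3.
have addr3 : regs s3 r_addr = base + v by rewrite F3.
have i3 : regs s3 r_i = k.+1 by rewrite F3.
have sel3 : regs s3 r_sel = regs s2 r_sel by rewrite F3.
have {}c3 : regs s3 r_count = nbr_with N A (fun v => labels (regs s) v == 0) v.
  rewrite c3; apply: eq_nbr_with => w wN.
  by rewrite (frame_labels _ _ F2) // F2 // lab0.
pose l4 := [:: ISub r_x r_count r_four; ILoad r_y r_addr; IAdd r_test r_x r_y].
pose s4 := exec_line s3 l4.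
have r4 : runs (Line l4) s3 3 s4 by apply: runs_line.
have F4 : frame r_test r_i (regs s) (regs s4).
  by move=> i hi; rewrite /= !upd_neq ?F3' //; outside.
have t4 : (regs s4 r_test == 0) = peelable (labels (regs s)) v.
  rewrite /= /upd /= addr3 base_neq // -/(labels (regs s3) v).
  by rewrite (frame_labels _ _ F3') // (F3' r_four) // c3 four addn_eq0 subn_eq0 andbC.
have io4 : tape_in s4 = tape_in s /\ tape_out s4 = tape_out s.
  by case: io2 => <- <-; case: io3 => <- <-.
have [row4 addr4 i4 sel4] : [/\ regs s4 r_row = base + N + v * N,
  regs s4 r_addr = base + v, regs s4 r_i = k.+1
  & regs s4 r_sel = regs s2 r_sel] by [].
clearbody s4.
have [s5 [r5 F5 sel5 io5]] : exists s5,
  [/\ runs (IfZ r_test (Line [:: IAdd r_sel r_addr r_zero])) s4 2 s5,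
    frame r_sel r_sel (regs s4) (regs s5),
    regs s5 r_sel = (if peelable (labels (regs s)) v then base + v else regs s2 r_sel)
    & tape_in s5 = tape_in s /\ tape_out s5 = tape_out s].
  rewrite -t4; case: eqP => t0.
    exists (exec_line s4 [:: IAdd r_sel r_addr r_zero]); split=> //.
    - by apply: runs_then t0 _; apply: runs_line.
    - by move=> i hi; rewrite /= upd_neq //; outside.
    by rewrite /= /upd /= addr4 F4 // h2 addn0.
  exists s4; split=> //; apply: (runs_le (t := 1)) => //.
  by apply: runs_skip; rewrite lt0n; apply/eqP.
pose s6 := exec_line s5 next_vertex.
have r6 : runs (Line next_vertex) s5 3 s6 by apply: runs_line.
have F5' : frame r_test r_i (regs s) (regs s5) by refine (frame_trans F4 F5 _ _ _ _).
exists s6; split.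
- have -> : 13 * N + 12 = (4 + N * 13) + (3 + (2 + 3)) by lia.
  exact: runs_seq r3 (runs_seq r4 (runs_seq r5 r6)).
- split=> //.
  + by lia.
  + by move=> i hi; rewrite /= !upd_neq ?F5' //; outside.
  + rewrite kE mulSn; split; rewrite /= /upd /=.
    * by rewrite F5 // row4 F5' // h3; lia.
    * by rewrite F5 // addr4 F5' // h1; lia.
    * by rewrite F5 // i4 F5' // h1; lia.
  + rewrite kE => -[u uv uP]; rewrite [regs s6 r_sel]/= /upd /= sel5.
    case: ifP => vP; first by exists v.
    apply: sel2; exists u => //; rewrite ltn_neqAle -ltnS uv andbT.
    by apply: contraFneq vP => <-.
- by rewrite /= /upd /= F5 // i4 F5' // h1; lia.
Qed.

Lemma ready_store X u c : u < N -> ready X -> ready (upd X (base + u) c).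
Proof.
move=> uN [[h1 h2 h3 h4 h5] h6]; split.
  by split; rewrite upd_neq // base_neqr.
by move=> v w vN wN; rewrite upd_neq ?h6 //; clear -uN; lia.
Qed.

Lemma labels_store X u c v : labels (upd X (base + u) c) v = upd (labels X) u c v.
Proof. by rewrite /labels /upd eqn_add2l. Qed.

Lemma peel_spec (s : state) : ready (regs s) ->
    (forall v, v < N -> labels (regs s) v = 0) ->
  exists s', [/\ runs peel s (4 + N * (N * (13 * N + 13) + 7)) s',
    ready (regs s'), peeled N A N (labels (regs s')), regs s' r_mark = 6 + N
    & tape_in s' = tape_in s /\ tape_out s' = tape_out s].
Proof.
move=> R lab0.
pose I k s' := [/\ k <= N, ready (regs s'),
  [/\ regs s' r_label = 0, regs s' r_four = 4, regs s' r_mark = 6 + (N - k)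
    & regs s' r_round = k],
  peeled N A (N - k) (labels (regs s'))
  & tape_in s' = tape_in s /\ tape_out s' = tape_out s].
rewrite /peel; set l1 := [:: _, _ & _]; set s1 := exec_line s l1.
have F1 : frame r_four r_label (regs s) (regs s1).
  by move=> i hi; rewrite /= !upd_neq //; outside.
have R1 := frame_ready (isT : r_zero < r_four) (isT : r_label < base) F1 R.
set body := (X in Rep r_round X).
suff step k s2 : I k.+1 s2 ->
  exists s3, [/\ runs body s2 (N * (13 * N + 13) + 6) s3, I k s3 & regs s3 r_round = k].
  have I1 : I N s1.
    split=> //; rewrite ?subnn.
      by split=> //; have [[_ h2 h3 _ _] _] := R; rewrite /= /upd /= h2 h3 addn0.
    apply: (peeled_ext (a := fun=> 0)) => [v vN|].
      by rewrite (frame_labels _ _ F1) ?lab0.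
    split=> [v vN|v vN|] //; first by left.
    by rewrite subn0 (@eq_count _ _ predT) // count_predT size_iota.
  have [s2 r2 [_ R2 [_ _ mk2 _] P2 io2]] := runs_repeat step N0 I1.
  rewrite subn0 in mk2 P2.
  by exists s2; split=> //; rewrite -addnS in r2; apply: runs_seq r2; exact: runs_line.
case=> kN R2 [label2 four2 mark2 round2] P2 io2.
have ex : exists2 u, u < N & peelable (labels (regs s2)) u.
  apply: (@Adeg (fun u => labels (regs s2) u == 0)).
  by case: P2 => _ _; rewrite has_count => ->; clear -kN; lia.
have [s3 [r3 F3 [u uN [/andP[/eqP u0 ud] sel3]] io3]] := select_spec R2 label2 four2 ex.
pose s4 := exec_line s3 [:: IStore r_sel r_mark; IAdd r_mark r_mark r_one;
             ISub r_round r_round r_one].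
have R3 := frame_ready (isT : r_four <= r_test) (isT : r_i < base) F3 R2.
have one3 : regs s3 r_one = 1 by case: R3 => [[]].
pose X := upd (regs s3) (base + u) (6 + (N - k.+1)).
have mark3 : regs s3 r_mark = 6 + (N - k.+1) by rewrite F3.
have F4 : frame r_round r_mark X (regs s4).
  move=> i hi; rewrite /= sel3 mark3 -/X ![upd _ _ _ i]upd_neq //; outside.
have mark4 : regs s4 r_mark = 6 + (N - k).
  rewrite /= sel3 mark3 /upd /= ?base_neqr //.
  by rewrite mark3 one3; clear -kN; lia.
have round4 : regs s4 r_round = k.
  rewrite /= sel3 mark3 /upd /= ?base_neqr //.
  by rewrite F3 // round2 one3 subn1.
exists s4; split=> //.
  have -> : N * (13 * N + 13) + 6 = 3 + N * (13 * N + 13) + 3 by clear; lia.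
  exact: runs_seq r3 (runs_line _ _).
have RX : ready X by apply: ready_store.
have R4 := frame_ready (isT : r_four <= r_round) (isT : r_mark < base) F4 RX.
have X_reg i : i < base -> X i = regs s3 i.
  by move=> iB; rewrite /X upd_neq // base_neqr.
split=> //; first by clear -kN; lia.
- by split=> //; rewrite F4 // X_reg // F3.
- have -> : N - k = (N - k.+1).+1 by clear -kN; lia.
  apply: peeled_ext (peeled_step Airr P2 uN u0 ud) => v vN.
  rewrite (frame_labels _ _ F4) // labels_store /upd.
  by rewrite (frame_labels _ _ F3).
- by case: io2 => <- <-; case: io3 => <- <-.
Qed.

Definition free (a : nat -> nat) i c := nbr_with N A (fun w => a w == c) i == 0.

Lemma color_vertex_spec (s : state) i : ready (regs s) -> i < N ->
    regs s r_row = base + N + i * N -> regs s r_addr = base + i ->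
    (exists2 c, 1 <= c <= 5 & free (labels (regs s)) i c) ->
  exists s' c, [/\ runs color_vertex s (65 * N + 42) s',
    (1 <= c <= 5) && free (labels (regs s)) i c,
    frame r_label r_sel (upd (regs s) (base + i) c) (regs s')
    & tape_in s' = tape_in s /\ tape_out s' = tape_out s].
Proof.
move=> R iN row addr [c0 c05 free0].
pose I k s' := [/\ k <= 5, frame r_label r_sel (regs s) (regs s'),
  regs s' r_label = k,
  (exists2 c, k < c <= 5 & free (labels (regs s)) i c) ->
  exists2 c, (1 <= c <= 5) && free (labels (regs s)) i c & regs s' r_sel = c
  & tape_in s' = tape_in s /\ tape_out s' = tape_out s].
rewrite /color_vertex; set l1 := [:: _]; set s1 := exec_line s l1.
have I1 : I 5 s1.
  split=> //; first by move=> j hj; rewrite /= upd_neq //; outside.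
  by case=> c; lia.
set body := (X in Rep r_label X).
suff step k s2 : I k.+1 s2 -> exists s3,
    [/\ runs body s2 (13 * N + 7) s3, I k s3 & regs s3 r_label = k].
  have [s2 r2 [_ F2 lab2 sel2 io2]] := runs_repeat step (isT : 0 < 5) I1.
  case: sel2 => [|c cP sel2]; first by exists c0.
  exists (exec_line s2 [:: IStore r_addr r_sel]), c; split=> //.
    have -> : 65 * N + 42 = 1 + (5 * (13 * N + 8) + 1) by clear; lia.
    rewrite -addnS in r2.
    by apply: runs_seq; [exact: runs_line | apply: runs_seq r2 _; exact: runs_line].
  move=> j hj; rewrite /= F2 // addr sel2 /upd; case: eqP => // _.
  exact: F2.
case=> k5 F2 lab2 sel2 io2.
have R2 := frame_ready (isT : r_four <= r_label) (isT : r_sel < base) F2 R.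
have row2 : regs s2 r_row = base + N + i * N by rewrite F2.
have [s3 [r3 F3 c3 io3]] := count_nbrs_spec R2 iN row2.
have F3' : frame r_label r_sel (regs s) (regs s3) by refine (frame_trans F2 F3 _ _ _ _).
have t3 : (regs s3 r_count == 0) = free (labels (regs s)) i k.+1.
  rewrite c3 lab2 /free; congr (_ == _); apply: eq_nbr_with => w wN.
  by rewrite (frame_labels _ _ F2).
have lab3 : regs s3 r_label = k.+1 by rewrite F3.
have sel3 : regs s3 r_sel = regs s2 r_sel by rewrite F3.
have [[one zero _ _ _] _] := R.
have [s4 [r4 F4 sel4 io4]] : exists s4,
  [/\ runs (IfZ r_count (Line [:: IAdd r_sel r_label r_zero])) s3 2 s4,
    frame r_sel r_sel (regs s3) (regs s4),
    regs s4 r_sel = (if free (labels (regs s)) i k.+1 then k.+1 else regs s2 r_sel)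
    & tape_in s4 = tape_in s /\ tape_out s4 = tape_out s].
  have io3' : tape_in s3 = tape_in s /\ tape_out s3 = tape_out s.
    by case: io2 => <- <-; case: io3 => <- <-.
  rewrite -t3; case: eqP => t0.
    exists (exec_line s3 [:: IAdd r_sel r_label r_zero]); split=> //.
    - by apply: runs_then t0 _; apply: runs_line.
    - by move=> j hj; rewrite /= upd_neq //; outside.
    by rewrite /= /upd /= lab3 (F3' r_zero) // zero addn0.
  exists s3; split=> //; apply: (runs_le (t := 1)) => //.
  by apply: runs_skip; rewrite lt0n; apply/eqP.
have F4' : frame r_label r_sel (regs s) (regs s4) by refine (frame_trans F3' F4 _ _ _ _).
pose s5 := exec_line s4 [:: ISub r_label r_label r_one].
have lab5 : regs s5 r_label = k.
  by rewrite /= /upd /= F4 // lab3 F4' // one subn1.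
exists s5; split=> //.
  have -> : 13 * N + 7 = 4 + N * 13 + (2 + 1) by clear; lia.
  exact: runs_seq r3 (runs_seq r4 (runs_line _ _)).
split=> //; first by clear -k5; lia.
  by move=> j hj; rewrite /= upd_neq ?F4' //; outside.
case=> c kc cfree; rewrite [regs s5 r_sel]/= /upd /= sel4.
case: ifP => kfree; first by exists k.+1; rewrite ?kfree ?k5.
apply: sel2; exists c => //.
have : c != k.+1 by apply: contraFneq kfree => <-.
by move: kc; clear; lia.
Qed.

Lemma color_spec (s : state) : ready (regs s) -> regs s r_mark = 6 + N ->
    peeled N A N (labels (regs s)) ->
  exists s', [/\ runs color s (1 + N * (N * (65 * N + 51) + 6)) s',
    ready (regs s'), colored N A (labels (regs s)) 5 0 (labels (regs s'))
    & tape_in s' = tape_in s /\ tape_out s' = tape_out s].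
Proof.
move=> R mark P0; set a0 := labels (regs s).
pose I k s' := [/\ k <= N, ready (regs s'),
  regs s' r_mark = 6 + k /\ regs s' r_round = k,
  colored N A a0 (5 + k) 0 (labels (regs s'))
  & tape_in s' = tape_in s /\ tape_out s' = tape_out s].
rewrite /color; set l1 := [:: _]; set s1 := exec_line s l1.
have F1 : frame r_round r_round (regs s) (regs s1).
  by move=> i hi; rewrite /= upd_neq //; outside.
have R1 := frame_ready (isT : r_four <= r_round) (isT : r_round < base) F1 R.
have I1 : I N s1.
  split=> //; first by have [[_ h2 h3 _ _] _] := R; rewrite /= /upd /= h2 h3 addn0.
  apply: colored_ext (colored_start P0) => v _.
  by rewrite (frame_labels _ _ F1).
set body := (X in Rep r_round X).
suff step k s2 : I k.+1 s2 -> exists s3,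
    [/\ runs body s2 (N * (65 * N + 51) + 5) s3, I k s3 & regs s3 r_round = k].
  have [s2 r2 [_ R2 _ C2 io2]] := runs_repeat step N0 I1.
  by exists s2; split=> //; rewrite -addnS in r2; apply: runs_seq r2; exact: runs_line.
case=> kN R2 [mark2 round2] C2 io2.
rewrite /body; set l3 := (_ :: first_vertex); pose s3 := exec_line s2 l3.
set m := 6 + k; have C2' : colored N A a0 m 0 (labels (regs s2)).
  by rewrite /m -[6 + k]/(5 + k).+1 -addnS.
pose J j s' := [/\ j <= N, ready (regs s'),
  [/\ regs s' r_row = base + N + (N - j) * N, regs s' r_addr = base + (N - j),
      regs s' r_i = j, regs s' r_mark = m & regs s' r_round = k.+1],
  colored N A a0 m (N - j) (labels (regs s'))
  & tape_in s' = tape_in s /\ tape_out s' = tape_out s].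
have F3 : frame r_mark r_i (regs s2) (regs s3).
  by move=> i hi; rewrite /= !upd_neq //; outside.
have J3 : J N s3.
  have [[h1 h2 h3 h4 h5] _] := R2.
  split; rewrite ?subnn //.
  split; rewrite /= /upd /= ?h1 ?h2 ?h3 ?h4 ?h5 ?addn0 //.
  by rewrite mark2 /m; clear; lia.
set body2 := (X in Rep r_i X).
suff step j s4 : J j.+1 s4 -> exists s5,
    [/\ runs body2 s4 (65 * N + 50) s5, J j s5 & regs s5 r_i = j].
  have [s4 r4 [_ R4 [_ _ _ mark4 round4] C4 io4]] := runs_repeat step N0 J3.
  pose s5 := exec_line s4 [:: ISub r_round r_round r_one].
  have F5 : frame r_round r_round (regs s4) (regs s5).
    by move=> i hi; rewrite /= upd_neq //; outside.
  have round5 : regs s5 r_round = k.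
    by have [[one _ _ _ _] _] := R4; rewrite /= /upd /= round4 one subn1.
  exists s5; split=> //.
    rewrite -addnS in r4.
    have -> : N * (65 * N + 51) + 5 = 4 + (N * (65 * N + 51) + 1) by clear; lia.
    apply: runs_seq; first exact: (runs_line (is_ := l3)).
    by apply: runs_seq r4 _; apply: runs_line.
  split=> //; first by clear -kN; lia.
  rewrite subn0 in C4; apply: colored_ext (colored_next C4) => v _.
  by rewrite (frame_labels _ _ F5).
case=> jN R4 [row4 addr4 i4 mark4 round4] C4 io4.
pose v := N - j.+1; have vN : v < N by rewrite /v; clear -jN; lia.
have jE : N - j = v.+1 by rewrite /v; clear -jN; lia.
rewrite -/v in row4 addr4 C4.
rewrite /body2; set l5 := [:: _, _, _ & _]; pose s5 := exec_line s4 l5.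
have F5 : frame r_test r_y (regs s4) (regs s5).
  by move=> i hi; rewrite /= !upd_neq //; outside.
have R5 := frame_ready (isT : r_four <= r_test) (isT : r_y < base) F5 R4.
have L5 w : labels (regs s5) w = labels (regs s4) w by rewrite (frame_labels _ _ F5).
have t5 : (regs s5 r_test == 0) = (labels (regs s4) v == m).
  rewrite /= /upd /= addr4 -/(labels (regs s4) v) mark4.
  by rewrite addn_eq0 !subn_eq0 -eqn_leq.
have row5 : regs s5 r_row = base + N + v * N by [].
have addr5 : regs s5 r_addr = base + v by [].
have r5 : runs (Line l5) s4 4 s5 by apply: runs_line.
have io5 : tape_in s5 = tape_in s /\ tape_out s5 = tape_out s by [].
have C5 : colored N A a0 m v (labels (regs s5)).
  by apply: colored_ext C4 => w _; rewrite L5.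
clearbody s5.
have [s6 [r6 F6 R6 C6 io6]] : exists s6,
   [/\ runs (IfZ r_test color_vertex) s5 (65 * N + 43) s6,
     forall i, i < base -> (i < r_label) || (r_sel < i) -> regs s6 i = regs s5 i,
     ready (regs s6), colored N A a0 m v.+1 (labels (regs s6))
     & tape_in s6 = tape_in s /\ tape_out s6 = tape_out s].
  have [t0|t0] := eqVneq (regs s5 r_test) 0; last first.
    exists s5; split=> //.
      by apply: (runs_le (t := 1)); [clear; lia | apply: runs_skip; rewrite lt0n].
    by apply: colored_skip => //; rewrite L5 -t5.
  have am : labels (regs s5) v = m by apply/eqP; rewrite L5 -t5 t0.
  have [|s6 [c [r6 /andP[c5 /eqP cfree] F6 io6]]] :=
      color_vertex_spec R5 vN row5 addr5.
    have [c c5 cfree] := colored_free P0 vN C5 am isT.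
    by exists c => //; rewrite /free cfree.
  exists s6; split.
  - by rewrite [_ + 43]addnS; apply: runs_then.
  - by move=> i iB /F6->; rewrite upd_neq // base_neqr.
  - apply: frame_ready (isT : r_four <= r_label) (isT : r_sel < base) F6 _.
    exact: ready_store.
  - apply: colored_ext (colored_step Asym Airr vN C5 am isT c5 cfree) => w _.
    by rewrite (frame_labels _ _ F6) // labels_store.
  - by case: io5 => <- <-; case: io6 => <- <-.
have G6 i : (i < r_label) || (r_y < i) && (r_sel < i < base) -> i < base ->
    regs s6 i = regs s4 i.
  by move=> hi iB; rewrite F6 ?F5 //; move: hi; clear; lia.
pose s7 := exec_line s6 next_vertex.
have F7 : frame r_row r_i (regs s6) (regs s7).
  by move=> i hi; rewrite /= !upd_neq //; outside.
exists s7; split.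
- have -> : 65 * N + 50 = 4 + ((65 * N + 43) + 3) by clear; lia.
  exact: runs_seq r5 (runs_seq r6 (runs_line _ _)).
- split=> //.
  + by clear -jN; lia.
  + have [[h1 h2 h3 h4 h5] _] := R6.
    rewrite jE mulSn; split; rewrite /= /upd /= ?G6 // ?h1 ?h3.
    * by rewrite row4 -(G6 r_n) // h3; clear; lia.
    * by rewrite addr4 -(G6 r_one) // h1; clear; lia.
    * by rewrite i4 -(G6 r_one) // h1 subn1.
  + by rewrite jE; apply: colored_ext C6 => w _; rewrite (frame_labels _ _ F7).
- by have [[h1 _ _ _ _] _] := R6; rewrite /= /upd /= h1 G6 // i4 subn1.
Qed.

Lemma read_matrix_spec (s : state) : constants (regs s) ->
    (forall v, v < N -> labels (regs s) v = 0) -> size (tape_in s) = N * N ->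
    (forall u v, u < N -> v < N -> nth 0 (tape_in s) (u * N + v) = A u v) ->
  exists s', [/\ runs read_matrix s (2 + N * (5 * N + 3)) s', ready (regs s'),
    (forall v, v < N -> labels (regs s') v = 0) & tape_out s' = tape_out s].
Proof.
move=> C lab0 sizeM nthM; set M := tape_in s in sizeM nthM.
pose loaded n s' := [/\ constants (regs s'), regs s' r_p = base + N + n,
  forall i, i < n -> regs s' (base + N + i) = nth 0 M i,
  forall v, v < N -> labels (regs s') v = 0
  & tape_in s' = drop n M /\ tape_out s' = tape_out s].
pose I k s' := [/\ k <= N, loaded ((N - k) * N) s' & regs s' r_i = k].
have [h1 h2 h3 h4 h5] := C.
rewrite /read_matrix; set l1 := [:: _; _]; set s1 := exec_line s l1.
have I1 : I N s1.
  split; rewrite // ?subnn; last by rewrite /= /upd /= h2 h3 addn0.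
  by split=> //; [rewrite /= /upd /= h2 h5|rewrite drop0].
set body := (X in Rep r_i X).
suff step k s2 : I k.+1 s2 -> exists s3,
    [/\ runs body s2 (5 * N + 2) s3, I k s3 & regs s3 r_i = k].
  have [s2 r2 [_ [C2 _ nth2 lab2 [_ out2]] _]] := runs_repeat step N0 I1.
  exists s2; split=> //.
    by rewrite -addnS in r2; apply: runs_seq r2; exact: runs_line.
  split=> // u v uN vN; rewrite subn0 in nth2.
  rewrite -[_ + v]addnA nth2 ?nthM //.
  apply: (@leq_trans (u * N + N)); first by rewrite ltn_add2l.
  by rewrite addnC -mulSn leq_mul2r uN orbT.
case=> kN L2 i2.
pose n := (N - k.+1) * N; rewrite -/n in L2.
have nE : (N - k) * N = n + N.
  by have -> : N - k = (N - k.+1).+1 by [clear -kN; lia]; rewrite mulSn addnC.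
pose J j s' := [/\ j <= N, loaded (n + (N - j)) s'
  & regs s' r_j = j /\ regs s' r_i = k.+1].
rewrite /body; set l3 := [:: _]; pose s3 := exec_line s2 l3.
have J3 : J N s3.
  case: L2 => C2 p2 nth2 lab2 io2; split; rewrite // ?subnn ?addn0 //.
  by split=> //; case: C2 => _ zero2 n2 _ _; rewrite /= /upd /= n2 zero2 addn0.
set body2 := (X in Rep r_j X).
suff step j s4 : J j.+1 s4 -> exists s5,
    [/\ runs body2 s4 4 s5, J j s5 & regs s5 r_j = j].
  have [s4 r4 [_ L4 [_ i4]]] := runs_repeat step N0 J3.
  rewrite subn0 in L4; have one4 : regs s4 r_one = 1 by case: L4 => [[]].
  pose s5 := exec_line s4 [:: ISub r_i r_i r_one].
  have i5 : regs s5 r_i = k by rewrite /= /upd /= i4 one4 subn1.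
  exists s5; split=> //; first (have -> : 5 * N + 2 = 1 + (N * 5 + 1) by clear; lia).
    apply: runs_seq; first exact: runs_line.
    by apply: runs_seq r4 _; apply: runs_line.
  by split; [clear -kN; lia| rewrite nE | ].
case=> jN [C4 p4 nth4 lab4 [in4 out4]] [j4 i4].
set t := n + (N - j.+1) in p4 nth4 in4.
have tE : n + (N - j) = t.+1 by rewrite /t; clear -jN; lia.
rewrite /body2; set l5 := [:: _, _ & _]; pose s5 := exec_line s4 l5.
have [one4 zero4 n4 labels4 matrix4] := C4.
have s5E i : i != r_x -> i != r_p -> i != r_j -> i != base + N + t ->
    regs s5 i = regs s4 i.
  move=> ix ip ij it; rewrite /= !upd_neq //; by rewrite /upd /= p4.
have tN q : q < base -> (base + N + t == q) = false.
  by rewrite -addnA; apply: base_neq.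
have p5 : regs s5 r_p = base + N + t.+1.
  by rewrite /= /upd /= p4 !(eq_sym _ (base + N + t)) !tN // one4 addn1 addnS.
have j5 : regs s5 r_j = j.
  by rewrite /= /upd /= p4 !(eq_sym _ (base + N + t)) !tN // one4 j4 subn1.
have new5 : regs s5 (base + N + t) = nth 0 M t.
  rewrite /= /upd /= p4 eqxx.
  by rewrite in4 -nth0 nth_drop addn0.
exists s5; split=> //; first exact: runs_line.
split=> //; first by clear -jN; lia.
  rewrite tE; split=> //.
  - by split; rewrite s5E // -addnA base_neqr.
  - move=> i; rewrite ltnS leq_eqVlt => /orP[/eqP->//|it].
    rewrite s5E ?nth4 //; try by rewrite -addnA base_neq.
    by rewrite eqn_add2l ltn_eqF.
  - move=> v vN; rewrite /labels s5E; try by rewrite base_neq.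
      exact: lab4.
    by rewrite -addnA eqn_add2l; move: vN; clear; lia.
  - by rewrite /= in4 -drop1 drop_drop.
split=> //; rewrite s5E // -addnA base_neqr //.
Qed.

Lemma print_colors_spec (s : state) : ready (regs s) ->
  exists2 s', runs print_colors s (2 + N * 6) s' &
    tape_out s' = tape_out s ++ [seq (labels (regs s) v).-1 | v <- iota 0 N].
Proof.
move=> [[h1 h2 h3 h4 h5] _].
pose I k s' := [/\ k <= N, frame r_x r_i (regs s) (regs s'),
  regs s' r_addr = base + (N - k) /\ regs s' r_i = k
  & tape_out s' = tape_out s ++ [seq (labels (regs s) v).-1 | v <- iota 0 (N - k)]].
rewrite /print_colors; set l1 := [:: _; _]; set s1 := exec_line s l1.
have I1 : I N s1.
  split; rewrite // ?subnn ?cats0 //.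
    by move=> i hi; rewrite /= !upd_neq //; outside.
  by rewrite /= /upd /= h2 h3 h4 !addn0.
set body := (X in Rep r_i X).
suff step k s2 : I k.+1 s2 -> exists s3,
    [/\ runs body s2 5 s3, I k s3 & regs s3 r_i = k].
  have [s2 r2 [_ _ _]] := runs_repeat step N0 I1; rewrite subn0 => out2.
  by exists s2 => //; apply: runs_seq r2; exact: runs_line.
case=> kN F2 [addr2 i2] out2.
have kE : N - k = (N - k.+1) + 1 by clear -kN; lia.
rewrite /body; set l3 := [:: _, _ & _]; pose s3 := exec_line s2 l3.
have one2 : regs s2 r_one = 1 by rewrite F2.
have i3 : regs s3 r_i = k by rewrite /= /upd /= i2 one2 subn1.
exists s3; split=> //; first exact: runs_line.
split=> //; first by clear -kN; lia.
- by move=> i hi; rewrite /= !upd_neq ?F2 //; outside.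
- by split=> //; rewrite /= /upd /= addr2 one2 kE addnA.
rewrite kE iotaD map_cat catA -out2 /= -cats1 /upd /= addr2 one2.
by rewrite -/(labels (regs s2) _) (frame_labels _ _ F2) // subn1.
Qed.

(** The bound is the sum of the costs of the parts, in which the cubic terms
    come from counting neighbors in three nested loops. *)
Lemma coloring_program_spec M :
    size M = N * N ->
    (forall u v, u < N -> v < N -> nth 0 M (u * N + v) = A u v) ->
  exists a : nat -> nat,
    [/\ forall v, v < N -> 1 <= a v <= 5,
        forall u v, u < N -> v < N -> A u v -> a u != a v
      & computes_within (compile 0 coloring_program) (N :: M) (100 * N.+1 ^ 3)
          [seq (a v).-1 | v <- iota 0 N]].
Proof.
move=> sizeM nthM.
pose s0 := State (fun=> 0) (N :: M) [::].
pose l0 := [:: IRead r_n; IConst r_one 1; ISub r_test r_one r_n].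
pose s1 := exec_line s0 l0.
pose s2 := exec_line s1 [:: IConst r_labels base; IAdd r_matrix r_labels r_n].
have test1 : regs s1 r_test = 0 by rewrite /= /upd /=; clear -N0; lia.
have lab2 v : v < N -> labels (regs s2) v = 0.
  by move=> _; rewrite /labels /= !upd_neq ?base_neq.
have [s3 [r3 R3 lab3 out3]] : exists s',
    [/\ runs read_matrix s2 (2 + N * (5 * N + 3)) s', ready (regs s'),
      (forall v, v < N -> labels (regs s') v = 0) & tape_out s' = tape_out s2].
  exact: read_matrix_spec.
have [s4 [r4 R4 P4 mark4 [_ out4]]] := peel_spec R3 lab3.
have [s5 [r5 R5 C5 [_ out5]]] := color_spec R4 mark4 P4.
have [s6 r6 out6] := print_colors_spec R5.
have [a15 aproper] := colored_end P4 C5.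
exists (labels (regs s5)); split=> //.
have {out6} <- : tape_out s6 = [seq (labels (regs s5) v).-1 | v <- iota 0 N].
  by rewrite out6 out5 out4 out3.
apply: runs_computes; apply: (@runs_le _ _ (3 +
  (2 + (2 + N * (5 * N + 3) + (4 + N * (N * (13 * N + 13) + 7) +
   (1 + N * (N * (65 * N + 51) + 6) + (2 + N * 6))))).+1)).
  rewrite !expnS expn0; clear; nia.
apply: runs_seq; first exact: (runs_line (is_ := l0)).
apply: runs_then test1 _.
by apply: runs_seq (runs_seq r3 (runs_seq r4 (runs_seq r5 r6))); apply: runs_line.
Qed.

End Correctness.

(** * Five colors in polynomial time *)

Lemma nth_allpairs (S T R : Type) (f : S -> T -> R) s t x y z u v :
  u < size s -> v < size t ->
  nth z [seq f a b | a <- s, b <- t] (u * size t + v) = f (nth x s u) (nth y t v).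
Proof.
elim: s u => // a s IH [|u] /= us vt; rewrite nth_cat size_map.
  by rewrite mul0n add0n vt (nth_map y).
by rewrite mulSn -addnA ltnNge leq_addr addKn IH.
Qed.

Theorem theorem1p5 :
  colorable_in_polynomial_time 5
    (fun G : sgraph => ASP G /\ ~ subgraph (complete 6) G).
Proof.
exists (compile 0 coloring_program), 100, 3 => G [aspG noK6].
have [G0|N0] := posnP #|G|.
  have noG (x : G) : False by have := card0_eq G0 x; rewrite inE.
  exists (fun=> ord0); split; first by move=> x; case: (noG x).
  have enum0 : enum G = [::] by apply: size0nil; rewrite -cardE.
  rewrite /encode_graph /encode_coloring enum0 G0.
  pose l := [:: IRead r_n; IConst r_one 1; ISub r_test r_one r_n].
  pose s := exec_line (State (fun=> 0) [:: 0] [::]) l.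
  have -> : [seq val (@ord0 4) | _ <- [::] : seq G] = tape_out s by [].
  apply: runs_computes; apply: (@runs_le _ _ (3 + 1)) => //.
  by apply: (runs_seq (s1 := s)); [exact: runs_line | exact: runs_skip].
have [x0 _] : exists x : G, x \in predT by apply/existsP; rewrite -lt0n.
set N := #|G| in N0 *; pose w := nth x0 (enum G).
pose A u v := w u -- w v.
have sizeG : size (enum G) = N by rewrite -cardE.
pose idx (x : G) := index x (enum G).
have idxN x : idx x < N by rewrite -sizeG index_mem mem_enum.
have wK x : w (idx x) = x by rewrite /w nth_index // mem_enum.
have w_inj u v : u < N -> v < N -> w u = w v -> u = v.
  move=> uN vN /eqP; rewrite /w nth_uniq ?sizeG ?enum_uniq //.
  by move/eqP.
have [|||||a [a15 aproper run]] := @coloring_program_spec N A N0 _ _ _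
    [seq nat_of_bool (x -- y) | x <- enum G, y <- enum G].
- by move=> u v _ _; apply: edge_sym.
- by move=> u _; apply: edge_irrefl.
- move=> P /hasP[u]; rewrite mem_iota add0n => uN Pu.
  pose S := [set x | P (idx x)].
  have idxw v : v < N -> idx (w v) = v by move=> vN; apply: w_inj; rewrite ?wK.
  have S0 : S != set0 by apply/set0Pn; exists (w u); rewrite inE idxw.
  have [x xS xdeg] := ASP_degenerate aspG noK6 S0.
  exists (idx x) => //; rewrite inE in xS; rewrite xS.
  apply: leq_trans xdeg; rewrite /nbr_with -size_filter cardE -(size_map w).
  apply: uniq_leq_size.
    rewrite map_inj_in_uniq ?filter_uniq ?iota_uniq // => y z.
    by rewrite !mem_filter !mem_iota => /andP[_ yN] /andP[_ zN]; apply: w_inj.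
  move=> _ /mapP[v + ->]; rewrite mem_filter mem_iota mem_enum !inE /A wK.
  by case/andP=> /andP[-> Pv] vN; rewrite idxw // Pv.
- by rewrite size_allpairs sizeG.
- by move=> u v uN vN; rewrite -{1}sizeG (nth_allpairs _ x0 x0) ?sizeG.
have cE x : (inord (a (idx x)).-1 : 'I_5) = (a (idx x)).-1 :> nat.
  by rewrite inordK //; case: (a (idx x)) (a15 _ (idxN x)).
exists (fun x => inord (a (idx x)).-1 : 'I_5); split.
  move=> x y xy; rewrite -(inj_eq val_inj) /= !cE.
  have := aproper _ _ (idxN x) (idxN y); rewrite /A !wK => /(_ xy).
  case: (a (idx x)) (a15 _ (idxN x)) => // i _.
  by case: (a (idx y)) (a15 _ (idxN y)).
suff -> : encode_coloring (fun x => inord (a (idx x)).-1 : 'I_5)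
          = [seq (a v).-1 | v <- iota 0 N] by [].
rewrite /encode_coloring; apply: (@eq_from_nth _ 0) => [|v];
  rewrite size_map sizeG ?size_map ?size_iota // => vN.
rewrite (nth_map x0) ?sizeG // (nth_map 0) ?size_iota // nth_iota // add0n /= cE.
by congr (a _).-1; apply: w_inj; rewrite ?wK.
Qed.
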